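(* Let $s\in\mathbb R$ and $p\in(1,\infty)$. The following continuous embeddings hold. (i) For all $\gamma\in\mathbb R$, $$\dot{\mathcal B}^s_p(\gamma,r)\hookrightarrow\dot B^s_r[L^{p,r}],\quad p\le r\le\infty,$$ $$\dot B^s_r[L^{p,r}]\hookrightarrow\dot{\mathcal B}^s_p(\gamma,r),\quad 1\le r\le p.$$ (ii) Let $\gamma\neq0$. Then $$\dot F^s_{p,r}\hookrightarrow\dot{\mathcal B}^s_p(\gamma,r),\quad p\le r\le\infty,$$ $$\dot{\mathcal B}^s_p(\gamma,r)\hookrightarrow\dot F^s_{p,r},\quad 1\le r\le p.$$
   Context: Lorentz spaces: for a measure space $(\Omega,\mu)$ and $1<p<\infty$, $1\le r<\infty$, $L^{p,r}(\Omega,\mu)$ is the space of measurable $g$ with $[g]_{L^{p,r}}=\big(r\int_0^\infty\lambda^r\mu(\{|g|>\lambda\})^{r/p}\frac{d\lambda}{\lambda}\big)^{1/r}<\infty$, and $[g]_{L^{p,\infty}}=\sup_{\lambda>0}\lambda\,\mu(\{|g|>\lambda\})^{1/p}$; $\|\cdot\|_{L^{p,r}}$ denotes a norm equivalent to this quasi-norm. $L^{p,r}$ without a measure refers to Lebesgue measure on $\mathbb R^d$, $d\ge1$. Fix a radial $\varphi\in C_c^\infty(\mathbb R^d)$ with $\mathrm{supp}\,\varphi\subset\{3/4<|\xi|<7/4\}$, $\varphi=1$ on $\{7/8\le|\xi|\le9/8\}$ and $\sum_{k\in\mathbb Z}\varphi(2^{-k}\xi)=1$ for $\xi\ne0$;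 put $\widehat{L_kf}(\xi)=\varphi(2^{-k}\xi)\widehat f(\xi)$. $\mathcal S_\infty(\mathbb R^d)$ is the space of Schwartz functions whose Fourier transforms vanish to infinite order at $0$; its dual $\mathcal S_\infty'(\mathbb R^d)$ is identified with tempered distributions modulo polynomials. For $\gamma\in\mathbb R$ let $\mu_\gamma(E)=\sum_{k\in\mathbb Z}2^{-k\gamma}\int_{\mathbb R^d}\mathbf 1_E(x,k)\,dx$ on $\mathbb R^d\times\mathbb Z$, and $P^bf(x,k)=2^{kb}L_kf(x)$. $\dot{\mathcal B}^s_p(\gamma,r)$ is the space of $f\in\mathcal S_\infty'(\mathbb R^d)$ with $\|f\|_{\dot{\mathcal B}^s_p(\gamma,r)}=\|P^{s+\gamma/p}f\|_{L^{p,r}(\mathbb R^d\times\mathbb Z,\mu_\gamma)}<\infty$. $\dot B^s_q[L^{p,r}]$ and $\dot F^s_{p,q}$ are the subspaces of $\mathcal S_\infty'(\mathbb R^d)$ for which, respectively, $\|f\|_{\dot B^s_q[L^{p,r}]}=\big(\sum_{k\in\mathbb Z}2^{ksq}\|L_kf\|_{L^{p,r}}^q\big)^{1/q}$ and $\|f\|_{\dot F^s_{p,q}}=\big\|\big(\sum_{k\in\mathbb Z}2^{ksq}|L_kf|^q\big)^{1/q}\big\|_{L^p}$ are finite (usual modification, supremum over $k$, if $q=\infty$). *)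

(* Defs.v *)
From HB Require Import structures.
From mathcomp Require Import all_boot all_order all_algebra.
From mathcomp Require Import complex.
From mathcomp Require Import all_classical all_reals all_analysis.

Set Implicit Arguments.
Unset Strict Implicit.
Unset Printing Implicit Defensive.

Import Order.TTheory GRing.Theory Num.Theory.
Import numFieldNormedType.Exports.

Local Open Scope classical_set_scope.
Local Open Scope ring_scope.
Local Open Scope complex_scope.

(* R^d is 'rV[R]_d. Its sigma-algebra is generated by the coordinate maps; it
   is the Borel sigma-algebra. *)
Definition rV_display : measure_display. Proof. exact: default_measure_display. Qed.

Section rV_measurable.
Context {R : realType} {d : nat}.

Let coords : 'I_d -> 'rV[R]_d -> measurableTypeR R := fun i x => x ord0 i.

Let rV_set0 : g_sigma_preimage coords set0.
Proof. exact: sigma_algebra0. Qed.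

Let rV_setC A : g_sigma_preimage coords A -> g_sigma_preimage coords (~` A).
Proof. exact: sigma_algebraC. Qed.

Let rV_bigcup (F : (set 'rV[R]_d)^nat) :
  (forall i, g_sigma_preimage coords (F i)) ->
  g_sigma_preimage coords (\bigcup_i (F i)).
Proof. exact: sigma_algebra_bigcup. Qed.

HB.instance Definition _ := @isMeasurable.Build rV_display
  'rV[R]_d (g_sigma_preimage coords) rV_set0 rV_setC rV_bigcup.

Lemma measurable_coord (i : 'I_d) :
  measurable_fun [set: 'rV[R]_d] (fun x => x ord0 i : measurableTypeR R).
Proof.
move=> _ Y mY; rewrite setTI; apply: sub_sigma_algebra => /=.
rewrite -bigcup_seq/=; exists i => /=; first by rewrite mem_index_enum.
by exists Y => //; rewrite setTI.
Qed.

Lemma measurable_fun_rVP d1 (T : measurableType d1) (f : T -> 'rV[R]_d) :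
  (forall i, measurable_fun [set: T] (fun t => f t ord0 i : measurableTypeR R)) ->
  measurable_fun [set: T] f.
Proof.
move=> mf; have sub : g_sigma_preimage (fun i => coords i \o f) `<=` measurable.
  apply: smallest_sub; first exact: sigma_algebra_measurable.
  rewrite -bigcup_seq /= => A [i _ [B mB <-]].
  exact: (mf i measurableT).
move: sub; rewrite g_sigma_preimage_comp => sub _ A mA.
by apply: sub; exists A.
Qed.

End rV_measurable.

HB.instance Definition _ := isPointed.Build int 0.

HB.instance Definition _ := @isMeasurable.Build default_measure_display
  int discrete_measurable discrete_measurable0
  discrete_measurableC discrete_measurableU.

(* Lebesgue measure on R^n, as an iterated product measure. *)
Fixpoint lebesgue_rV (R : realType) (n : nat) : set 'rV[R]_n -> \bar R :=
  match n with
  | 0 => fun A => \d_(0 : 'rV[R]_0) A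
  | m.+1 => fun A =>
      (\int[@lebesgue_measure R]_x
         lebesgue_rV [set v : 'rV[R]_m | A (row_mx (x%:M : 'rV[R]_1) v)])%E
  end.

Section lebesgue_rV_measure.
Context {R : realType}.

Let cons_rV n (z : measurableTypeR R * 'rV[R]_n) : 'rV[R]_n.+1 :=
  row_mx (z.1%:M : 'rV[R]_1) z.2.

Let cons_rVl n z (j : 'I_1) : @cons_rV n z ord0 (lshift n j) = z.1.
Proof. by rewrite /cons_rV (@row_mxEl R 1 1 n) (ord1 j) mxE mulr1n. Qed.

Let cons_rVr n z (j : 'I_n) : @cons_rV n z ord0 (rshift 1 j) = z.2 ord0 j.
Proof. by rewrite /cons_rV (@row_mxEr R 1 1 n). Qed.

Let measurable_cons_rV n : measurable_fun setT (@cons_rV n).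
Proof.
apply: measurable_fun_rVP => i.
have [j ->|j ->] := split_ordP (i : 'I_(1 + n)).
- rewrite (_ : (fun t => _) = fst); first exact: measurable_fst.
  by apply/funext => t; rewrite cons_rVl.
- rewrite (_ : (fun t => _) = (fun x : 'rV[R]_n => x ord0 j) \o snd).
    exact: (measurableT_comp (measurable_coord j) measurable_snd).
  by apply/funext => t; rewrite cons_rVr.
Qed.

Let uncons_rV n (v : 'rV[R]_n.+1) : measurableTypeR R * 'rV[R]_n :=
  (v ord0 (lshift n (ord0 : 'I_1)), rsubmx (v : 'rV_(1 + n))).

Let measurable_uncons_rV n : measurable_fun setT (@uncons_rV n).
Proof.
apply/measurable_fun_pairP; split; first exact: measurable_coord.
apply: measurable_fun_rVP => i /=.
rewrite (_ : (fun t => _) = fun x : 'rV[R]_n.+1 => x ord0 (rshift 1 i)).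
  exact: measurable_coord.
by apply/funext => t /=; rewrite mxE.
Qed.

Let uncons_rVK n : cancel (@uncons_rV n) (@cons_rV n).
Proof.
move=> v; apply/matrixP => k i; rewrite ord1.
have [j ->|j ->] := split_ordP (i : 'I_(1 + n)).
- by rewrite cons_rVl /= (ord1 j).
- by rewrite cons_rVr /= mxE.
Qed.

Let cons_rVK n : cancel (@cons_rV n) (@uncons_rV n).
Proof.
by case=> a v; rewrite /uncons_rV cons_rVl /= /cons_rV /= (@row_mxKr R 1 1 n).
Qed.

Let consm n (nu : {sigma_finite_measure set 'rV[R]_n -> \bar R}) :=
  (fun A : set 'rV[R]_n.+1 =>
    (@lebesgue_measure R \x nu)%E (@cons_rV n @^-1` A) : \bar R).

Section consm.
Variables (n : nat) (nu : {sigma_finite_measure set 'rV[R]_n -> \bar R}).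

Let meas_pre A : measurable A -> measurable (@cons_rV n @^-1` A).
Proof. by move=> mA; rewrite -[X in measurable X]setTI; exact: measurable_cons_rV. Qed.

Let consm0 : consm nu set0 = 0%E.
Proof. by rewrite /consm preimage_set0 measure0. Qed.

Let consm_ge0 A : (0 <= consm nu A)%E.
Proof. exact: measure_ge0. Qed.

Let consm_sigma_additive : semi_sigma_additive (consm nu).
Proof.
move=> F mF tF mUF; rewrite /consm preimage_bigcup.
apply: measure_semi_sigma_additive.
- by move=> k; exact: meas_pre.
- apply/trivIsetP => /= i j _ _ ij; rewrite -preimage_setI.
  by move/trivIsetP : tF => /(_ _ _ _ _ ij) ->//; rewrite preimage_set0.
- by rewrite -preimage_bigcup; exact: meas_pre.
Qed.

HB.instance Definition _ := isMeasure.Build _ _ _ (consm nu)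
  consm0 consm_ge0 consm_sigma_additive.

Let prod_sigma_finite : sigma_finite setT (@lebesgue_measure R \x nu)%E.
Proof.
have /sigma_finiteP[F [TF ndF Foo]] := sigma_finiteT (@lebesgue_measure R).
have /sigma_finiteP[G [TG ndG Goo]] := sigma_finiteT nu.
exists (fun n => F n `*` G n).
  rewrite -setXTT TF TG predeqE => -[x y]; split.
    move=> [/= [i _ Fix] [k _ Gky]]; exists (maxn i k) => //; split.
    - by move: x Fix; exact/subsetPset/ndF/leq_maxl.
    - by move: y Gky; exact/subsetPset/ndG/leq_maxr.
  by move=> [i _ []/= ? ?]; split; exists i.
move=> k; have [? ?] := Foo k; have [? ?] := Goo k.
split; first exact: measurableX.
by rewrite product_measure1E// lte_mul_pinfty// ge0_fin_numE.
Qed.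

Let consm_sigma_finite : sigma_finite setT (consm nu).
Proof.
have [F FT Ffin] := prod_sigma_finite.
exists (fun k => @uncons_rV n @^-1` F k).
  by rewrite -preimage_bigcup -FT preimage_setT.
move=> k; have [mF Foo] := Ffin k; split.
  by rewrite -[X in measurable X]setTI; exact: measurable_uncons_rV.
rewrite /consm -comp_preimage (_ : _ \o _ = id) ?preimage_id//.
by apply/funext => z /=; rewrite cons_rVK.
Qed.

HB.instance Definition _ := Measure_isSigmaFinite.Build _ _ _ (consm nu)
  consm_sigma_finite.

End consm.

Let lebesgue_rV_ex n :
  exists mu : {sigma_finite_measure set 'rV[R]_n -> \bar R},
    (mu : set _ -> \bar R) = @lebesgue_rV R n.
Proof.
elim: n => [|n [nu nuE]]; first by exists (\d_(0 : 'rV[R]_0))%R.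
exists (consm nu : {sigma_finite_measure set _ -> \bar R}).
apply/funext => A /=; apply: eq_integral => x _ /=.
rewrite nuE; congr (lebesgue_rV _).
by apply/seteqP; split => v; rewrite /xsection /= inE.
Qed.

Let lebesgue_rV0 n : @lebesgue_rV R n set0 = 0%E.
Proof. by have [mu <-] := lebesgue_rV_ex n; exact: measure0. Qed.

Let lebesgue_rV_ge0 n A : (0 <= @lebesgue_rV R n A)%E.
Proof. by have [mu <-] := lebesgue_rV_ex n; exact: measure_ge0. Qed.

Let lebesgue_rV_sigma_additive n : semi_sigma_additive (@lebesgue_rV R n).
Proof. by have [mu <-] := lebesgue_rV_ex n; exact: measure_semi_sigma_additive. Qed.

HB.instance Definition _ n := isMeasure.Build _ _ _ (@lebesgue_rV R n)
  (lebesgue_rV0 n) (@lebesgue_rV_ge0 n) (@lebesgue_rV_sigma_additive n).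

Let lebesgue_rV_sigma_finite n : sigma_finite setT (@lebesgue_rV R n).
Proof. by have [mu <-] := lebesgue_rV_ex n; exact: sigma_finiteT. Qed.

HB.instance Definition _ n := Measure_isSigmaFinite.Build _ _ _
  (@lebesgue_rV R n) (@lebesgue_rV_sigma_finite n).

End lebesgue_rV_measure.

(* The measure of the section of E at k is \int 1_E(x, k) dx. *)
Definition mu_gamma (R : realType) (d : nat) (gamma : R)
    (E : set ('rV[R]_d * int)%type) : \bar R :=
  (\esum_(k in [set: int])
     (2 `^ (- (k%:~R * gamma)))%:E * lebesgue_rV [set x | E (x, k)])%E.

Section mu_gamma_measure.
Context {R : realType} {d : nat} (gamma : R).

Let meas_sec (E : set ('rV[R]_d * int)%type) k :
  measurable E -> measurable [set x | E (x, k)].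
Proof.
move=> mE; have := measurable_ysection k mE.
by congr measurable; apply/seteqP; split => x; rewrite /ysection /= inE.
Qed.

Let mu0 : mu_gamma gamma (set0 : set ('rV[R]_d * int)%type) = 0%E.
Proof.
rewrite /mu_gamma esum1// => k _.
by rewrite (_ : [set x | _] = set0) ?measure0 ?mule0//; apply/seteqP; split.
Qed.

Let mu_ge0 (E : set ('rV[R]_d * int)%type) : (0 <= mu_gamma gamma E)%E.
Proof. by apply: esum_ge0 => k _; rewrite mule_ge0// lee_fin powR_ge0. Qed.

Let mu_sigma_additive : semi_sigma_additive (@mu_gamma R d gamma).
Proof.
move=> F mF tF mUF.
have -> : mu_gamma gamma (\bigcup_n F n) = (\sum_(n <oo) mu_gamma gamma (F n))%E.
  rewrite nneseries_esumT; last by move=> n; exact: mu_ge0.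
  rewrite /mu_gamma.
  transitivity (\esum_(k in [set: int]) \esum_(n in [set: nat])
    ((2 `^ (- (k%:~R * gamma)))%:E * lebesgue_rV [set x | F n (x, k)]))%E.
    apply: eq_esum => k _; rewrite -nneseries_esumT; last first.
      by move=> n; rewrite mule_ge0// lee_fin powR_ge0.
    rewrite nneseriesZl//; congr (_ * _)%E.
    rewrite (_ : [set x | _] = \bigcup_n [set x | F n (x, k)]).
      apply/esym/cvg_lim => //; apply: measure_sigma_additive.
      - by move=> n; exact: meas_sec.
      - apply/trivIsetP => i j _ _ ij.
        move/trivIsetP : tF => /(_ _ _ I I ij) FF; apply/seteqP; split => // x /=.
        by move=> [? ?]; have : (F i `&` F j) (x, k) by []; rewrite FF.
    by apply/seteqP; split.
  rewrite esum_esum; last by move=> *; rewrite mule_ge0// lee_fin powR_ge0.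
  rewrite esum_esum; last by move=> *; rewrite mule_ge0// lee_fin powR_ge0.
  rewrite (reindex_esum ([set: nat] `*`` fun=> [set: int])
    _ (fun z => (z.2, z.1)))//.
  split=> //.
    by move=> [? ?] [? ?] _ _ [-> ->].
  by move=> [k n] _; exists (n, k).
exact: is_cvg_ereal_nneg_natsum.
Qed.

HB.instance Definition _ := isMeasure.Build _ _ _ (@mu_gamma R d gamma)
  mu0 mu_ge0 mu_sigma_additive.

End mu_gamma_measure.

Section complex_functions.
Context {R : realType}.

Definition cmod (z : R[i]) : R := Normc.normc z.

Definition cis (t : R) : R[i] := cos t +i* sin t.

Definition cmeasurable d (T : measurableType d) (g : T -> R[i]) : Prop :=
  measurable_fun setT (fun x => complex.Re (g x)) /\
  measurable_fun setT (fun x => complex.Im (g x)).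

Definition cintegral d (T : measurableType d) (mu : {measure set T -> \bar R})
    (g : T -> R[i]) : R[i] :=
  (\int[mu]_x complex.Re (g x)) +i* (\int[mu]_x complex.Im (g x)).

End complex_functions.

Section lorentz.
Local Open Scope ereal_scope.
Context {R : realType} {d} {T : measurableType d}.
Variable mu : {measure set T -> \bar R}.

Definition lorentz_qnorm (p : R) (r : \bar R) (g : T -> R[i]) : \bar R :=
  let m (l : R) := mu [set x | (l < cmod (g x))%R] in
  if r is r%:E then
    (r%:E * \int[lebesgue_measure]_(l in `]0%R, +oo[)
              ((l `^ r)%:E * (m l) `^ (r / p) * (l^-1)%:E)) `^ r^-1
  else ereal_sup [set l%:E * (m l) `^ p^-1 | l in [set l : R | (0 < l)%R]].

(* A norm on L^{p,r}(mu) equivalent to the quasi-norm; its value on measurable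
   functions outside of L^{p,r} is +oo. *)
Record lorentz_norm (p : R) (r : \bar R) := LorentzNorm {
  lnorm :> (T -> R[i]) -> \bar R;
  lnormD : forall g h, cmeasurable g -> cmeasurable h ->
    lnorm (fun x => g x + h x)%R <= lnorm g + lnorm h;
  lnormZ : forall (a : R[i]) g, cmeasurable g ->
    lnorm (fun x => a * g x)%R = (cmod a)%:E * lnorm g;
  lnorm_equiv : exists c C : R, [/\ (0 < c)%R, (0 < C)%R &
    forall g, cmeasurable g ->
      c%:E * lorentz_qnorm p r g <= lnorm g /\
      lnorm g <= C%:E * lorentz_qnorm p r g] }.

Definition in_lorentz p r (N : lorentz_norm p r) (g : T -> R[i]) : Prop :=
  cmeasurable g /\ N g < +oo.

End lorentz.

Section distributions.
Context {R : realType} {d : nat}.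
Local Notation Rd := 'rV[R]_d.
Implicit Types (f g psi chi : Rd -> R[i]) (x y xi : Rd).

Definition dot x y : R := \sum_(i < d) x ord0 i * y ord0 i.

Definition enorm x : R := Num.sqrt (dot x x).

Definition partial (j : 'I_d) f : Rd -> R[i] := fun x =>
  ('D_(delta_mx ord0 j) (fun y => complex.Re (f y)) x) +i*
  ('D_(delta_mx ord0 j) (fun y => complex.Im (f y)) x).

(* Multi-indices are written as words in the coordinates: partials [:: j; k] f
   is d_j d_k f, and monomial [:: j; k] x is x_j x_k. *)
Definition partials (w : seq 'I_d) f : Rd -> R[i] := foldr partial f w.

Definition monomial (w : seq 'I_d) x : R := \prod_(i <- w) x ord0 i.

Definition smooth f : Prop := forall (w : seq 'I_d),
  let re := fun x => complex.Re (partials w f x) : R in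
  let im := fun x => complex.Im (partials w f x) : R in
  [/\ continuous re, continuous im &
      forall (j : 'I_d) x, derivable re x (delta_mx ord0 j) /\
                           derivable im x (delta_mx ord0 j)].

Definition schwartz_seminorm (n : nat) f : \bar R :=
  ereal_sup [set y | exists u w : seq 'I_d, exists x,
    [/\ (size u <= n)%N, (size w <= n)%N &
        y = (`|monomial u x| * cmod (partials w f x))%:E]].

Definition schwartz f : Prop :=
  smooth f /\ forall n, (schwartz_seminorm n f < +oo)%E.

Definition fourier f : Rd -> R[i] := fun xi =>
  cintegral (@lebesgue_rV R d) (fun x => f x * cis (- dot x xi)).

Definition schwartz_infty psi : Prop :=
  schwartz psi /\ forall w : seq 'I_d, partials w (fourier psi) 0 = 0.

(* The dual of S_infty. A functional is represented by its extension by 0 to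
   all functions R^d -> C, so that equal functionals are equal as functions. *)
Record Sinfty_dual := SinftyDual {
  pairing :> (Rd -> R[i]) -> R[i];
  pairing_linear : forall (a : R[i]) psi chi,
    schwartz_infty psi -> schwartz_infty chi ->
    pairing (fun x => a * psi x + chi x) = a * pairing psi + pairing chi;
  pairing_continuous : exists n (C : R), forall psi, schwartz_infty psi ->
    ((cmod (pairing psi))%:E <= C%:E * schwartz_seminorm n psi)%E;
  pairing_out : forall psi, ~ schwartz_infty psi -> pairing psi = 0 }.

(* Fourier transform of a functional, its product with a function, and the
   inverse Fourier transform of a functional u of compact support, which is the
   function x |-> (2 pi)^-d u (e^{i <x, .>}). *)
Definition dist_fourier (u : (Rd -> R[i]) -> R[i]) : (Rd -> R[i]) -> R[i] :=
  fun psi => u (fourier psi).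

Definition dist_mul (m : Rd -> R[i]) (u : (Rd -> R[i]) -> R[i]) :
  (Rd -> R[i]) -> R[i] := fun psi => u (fun xi => m xi * psi xi).

Definition dist_inv_fourier (u : (Rd -> R[i]) -> R[i]) : Rd -> R[i] :=
  fun x => u (fun xi => (((2 * pi) ^- d)%:C * cis (dot x xi))).

(* L_k f. The function phi(2^-k .) e^{i <x, .>} is smooth with compact support
   away from 0, so f is only applied here to elements of S_infty. *)
Definition LP (phi : Rd -> R[i]) (f : Sinfty_dual) (k : int) : Rd -> R[i] :=
  dist_inv_fourier (dist_mul (fun xi => phi ((2 ^ (- k)) *: xi)) (dist_fourier f)).

Definition LP_cutoff (phi : Rd -> R[i]) : Prop :=
  let supp := closure [set xi | phi xi != 0] in
  [/\ smooth phi /\ compact supp,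
      forall xi eta, enorm xi = enorm eta -> phi xi = phi eta,
      supp `<=` [set xi | 3 / 4 < enorm xi < 7 / 4],
      forall xi, 7 / 8 <= enorm xi <= 9 / 8 -> phi xi = 1 &
      forall xi, xi != 0 -> \sum_(k \in [set: int]) phi ((2 ^ (- k)) *: xi) = 1].

End distributions.
Arguments Sinfty_dual R d : clear implicits.

Definition ell_norm (R : realType) (q : \bar R) (a : int -> \bar R) : \bar R :=
  (if q is q%:E then (\esum_(k in [set: int]) a k `^ q) `^ q^-1
   else ereal_sup (range a))%E.

Record subspace_with_norm (R : realType) (X : Type) := SubspaceWithNorm {
  carrier : set X;
  snorm : X -> \bar R }.

Definition embeds (R : realType) (X : Type) (A B : subspace_with_norm R X) :=
  exists2 C : R, 0 < C & forall f, carrier A f ->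
    carrier B f /\ (snorm B f <= C%:E * snorm A f)%E.

Section spaces.
Context {R : realType} {d : nat}.
Variable phi : 'rV[R]_d -> R[i].
Implicit Types (f : Sinfty_dual R d) (s p b gamma : R) (q r : \bar R).

Definition Pop b f (z : 'rV[R]_d * int) : R[i] :=
  (2 `^ (z.2%:~R * b))%:C * LP phi f z.2 z.1.

Definition calB_space s p gamma r
    (N : lorentz_norm (@mu_gamma R d gamma) p r) :=
  {| carrier := [set f | in_lorentz N (Pop (s + gamma / p) f)];
     snorm := fun f => N (Pop (s + gamma / p) f) |}.

Definition besov_lorentz_norm s q p r
    (N : lorentz_norm (@lebesgue_rV R d) p r) f : \bar R :=
  ell_norm q (fun k => (2 `^ (k%:~R * s))%:E * N (LP phi f k))%E.

(* Measurability of the functions L_k f is part of belonging to l^q(L^{p,r}),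
   and likewise to L^p(l^q) below. *)
Definition besov_lorentz_space s q p r
    (N : lorentz_norm (@lebesgue_rV R d) p r) :=
  {| carrier := [set f | (forall k, cmeasurable (LP phi f k)) /\
                         (besov_lorentz_norm s q N f < +oo)%E];
     snorm := besov_lorentz_norm s q N |}.

Definition triebel_lizorkin_norm s p q f : \bar R :=
  Lnorm (@lebesgue_rV R d) p%:E
    (fun x => ell_norm q (fun k => (2 `^ (k%:~R * s) * cmod (LP phi f k x))%:E)).

Definition triebel_lizorkin_space s p q :=
  {| carrier := [set f | (forall k, cmeasurable (LP phi f k)) /\
                         (triebel_lizorkin_norm s p q f < +oo)%E];
     snorm := triebel_lizorkin_norm s p q |}.

End spaces.

(* Main.v *)
Require Import Defs.
From mathcomp Require Import all_boot all_order all_algebra.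
From mathcomp Require Import complex.
From mathcomp Require Import all_classical all_reals all_analysis.
From mathcomp Require Import measurable_realfun.
From mathcomp Require Import ring lra zify.

(** Only the measurable functions a_k = 2^(k s) |L_k f| matter. Put
    theta = gamma / p; the distribution function of P^(s + gamma/p) f is
      m(l) = sum_k 2^(-k gamma) |{x : 2^(k theta) a_k(x) > l}|
           = int G(l, x) dx,
      G(l, x) = sum of 2^(-k gamma) over {k : 2^(k theta) a_k(x) > l}.
    (i) compares m(l)^(r/p) with the sum of the (r/p)-th powers of the terms of
    m(l), by super- or subadditivity of t^(r/p).
    (ii) for gamma <> 0, a sum of 2^(-k gamma) over any set of integers is
    comparable to its largest term, so that G^(r/p) is comparable to
    sum 2^(-k theta r) over the same set, and integration against
    d(l^r) on ]0, +oo[ turns the latter into sum_k a_k(x)^r.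
    Minkowski's integral inequality, with exponent r/p or p/r, then exchanges
    the integrals in l and x. For r = +oo, G(l, x) <= K (sup_k a_k(x) / l)^p
    is integrated in x. *)

Set Implicit Arguments.
Unset Strict Implicit.
Unset Printing Implicit Defensive.

Import Order.TTheory GRing.Theory Num.Theory.
Import numFieldNormedType.Exports.

Local Open Scope classical_set_scope.
Local Open Scope ring_scope.

(** The weights of [mu_gamma] and of P^(s + gamma/p) are tuned to each other: 2^(-k gamma) to the
    power 1/p is the inverse of 2^(k theta). A single frequency slice therefore contributes a
    quantity free of gamma, which is why (i) holds for every gamma. In (ii) different k meet at the
    same x, and this is where gamma <> 0 enters: the weights are then geometric in k, so those of
    them below a bound M add up to at most a constant times M. For gamma = 0 the sum would count the
    k, with no such bound. The ranges of r come from convexity: t^(r/p) is superadditive for r >= p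
    and subadditive for r <= p, and Minkowski's inequality needs an exponent at least 1, namely r/p
    with l as the outer variable when r >= p, and p/r with x as the outer variable when r <= p. The
    norms are known only up to equivalence with the quasi-norms, so the inequalities are proved for
    the quasi-norms and then transferred. *)

(** * Sums over the integers as series, and their integration term by term *)

Section esum_int.
Local Open Scope ereal_scope.
Context {R : realType}.

Definition int_of_nat (n : nat) : int := if odd n then Negz n./2 else Posz n./2.

Lemma int_of_nat_bij : set_bij [set: nat] [set: int] int_of_nat.
Proof.
split=> //.
- pose g (k : int) := match k with Posz n => n.*2 | Negz n => n.*2.+1 end.
  have gK : cancel int_of_nat g.
    move=> n; rewrite -[RHS]odd_double_half /int_of_nat.
    by case: (odd n) => /=; rewrite ?add1n ?add0n.
  by move=> m n _ _ /(congr1 g); rewrite !gK.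
- move=> [n|n] _; [exists n.*2 | exists n.*2.+1] => //.
    by rewrite /int_of_nat odd_double doubleK.
  by rewrite /int_of_nat /= odd_double /= uphalf_double.
Qed.

Lemma esum_int (a : int -> \bar R) : (forall k, 0 <= a k) ->
  \esum_(k in [set: int]) a k = \sum_(n <oo) a (int_of_nat n).
Proof.
move=> a0; rewrite (reindex_esum _ _ _ _ int_of_nat_bij) nneseries_esumT//.
Qed.

Lemma esum_intZl (c : R) (a : int -> \bar R) : (forall k, 0 <= a k) -> (0 <= c)%R ->
  \esum_(k in [set: int]) (c%:E * a k) = c%:E * \esum_(k in [set: int]) a k.
Proof.
move=> a0 c0; rewrite !esum_int//; last by move=> k; rewrite mule_ge0.
by rewrite nneseriesZl.
Qed.

Lemma le_esum_term (T : choiceType) (a : T -> \bar R) k : (forall k, 0 <= a k) ->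
  a k <= \esum_(k in [set: T]) a k.
Proof.
move=> a0; apply: esum_ge; exists [set k]; last by rewrite fsbig_set1.
by split => //; exact: finite_set1.
Qed.

Context d (T : measurableType d).
Implicit Type mu : {measure set T -> \bar R}.

Lemma measurable_esum_int (f : int -> T -> \bar R) :
  (forall k, measurable_fun [set: T] (f k)) -> (forall k x, 0 <= f k x) ->
  measurable_fun [set: T] (fun x => \esum_(k in [set: int]) f k x).
Proof.
move=> mf f0; under eq_fun do rewrite esum_int//.
exact: (@ge0_emeasurable_sum _ _ _ setT (fun n x => f (int_of_nat n) x) xpredT).
Qed.

Lemma integral_esum_int mu (f : int -> T -> \bar R) :
  (forall k, measurable_fun [set: T] (f k)) -> (forall k x, 0 <= f k x) ->
  \int[mu]_x (\esum_(k in [set: int]) f k x) =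
  \esum_(k in [set: int]) \int[mu]_x f k x.
Proof.
move=> mf f0; under eq_integral do rewrite esum_int//.
rewrite integral_nneseries// esum_int// => k; exact: integral_ge0.
Qed.

End esum_int.

(** * Super- and subadditivity of powers *)

Section powR_sums.
Local Open Scope ereal_scope.
Context {R : realType}.

Lemma le_poweR (q : R) (x y : \bar R) : (0 <= q)%R -> 0 <= x -> x <= y ->
  x `^ q <= y `^ q.
Proof.
move=> q0 x0 xy; apply: gt0_ler_poweR => //; rewrite in_itv/= ?leey ?andbT//.
exact: le_trans xy.
Qed.

Lemma poweRK (q : R) (x : \bar R) : (q != 0)%R -> 0 <= x -> (x `^ q) `^ q^-1 = x.
Proof. by move=> q0 x0; rewrite -poweRrM divff// poweRe1. Qed.

Lemma poweRVK (q : R) (x : \bar R) : (q != 0)%R -> 0 <= x -> (x `^ q^-1) `^ q = x.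
Proof. by move=> q0 x0; rewrite -poweRrM mulVf// poweRe1. Qed.

(** Each a_k is at most the sum S, so a_k^q <= S^(q-1) a_k; summing over k gives S^q. *)
Lemma esum_poweR_le (q : R) (a : int -> \bar R) : (1 <= q)%R ->
  (forall k, 0 <= a k) ->
  \esum_(k in [set: int]) a k `^ q <= (\esum_(k in [set: int]) a k) `^ q.
Proof.
move=> q1 a0; have q0 : (0 < q)%R by rewrite (lt_le_trans _ q1).
have a_le k := le_esum_term k a0.
set S := esum _ _ in a_le *.
have S0 : 0 <= S by exact: esum_ge0.
have [Soo|Soo] := eqVneq S +oo; first by rewrite Soo poweRyr ?gt_eqF// leey.
have Sfin : S \is a fin_num by rewrite ge0_fin_numE// ltey.
have -> : S `^ q = (fine S `^ (q - 1))%:E * S.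
  have [->|s0] := eqVneq S 0; first by rewrite poweR0r ?gt_eqF// mule0.
  rewrite -{1 3}(fineK Sfin) poweR_EFin -EFinM; congr (_%:E).
  rewrite -{3}(@powRr1 _ (fine S)) ?fine_ge0// -powRD ?subrK//.
  by apply/implyP => _; rewrite fine_eq0.
rewrite -esum_intZl ?powR_ge0//; apply: le_esum => k _.
have akfin : a k \is a fin_num.
  by rewrite ge0_fin_numE// (le_lt_trans (a_le k))// ltey.
rewrite -(fineK akfin) poweR_EFin -EFinM lee_fin.
have [->|ak0] := eqVneq (fine (a k)) 0%R; first by rewrite powR0 ?gt_eqF// mulr0.
have -> : (fine (a k) `^ q = fine (a k) `^ (q - 1) * fine (a k))%R.
  rewrite -{3}(@powRr1 _ (fine (a k))) ?fine_ge0// -powRD ?subrK//.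
  by apply/implyP.
apply: ler_wpM2r; rewrite ?fine_ge0//.
by rewrite ge0_ler_powR ?subr_ge0// ?nnegrE ?fine_ge0// fine_le.
Qed.

(** This is [esum_poweR_le] with exponent 1/q applied to the a_k^q. *)
Lemma esum_poweR_ge (q : R) (a : int -> \bar R) : (0 < q <= 1)%R ->
  (forall k, 0 <= a k) ->
  (\esum_(k in [set: int]) a k) `^ q <= \esum_(k in [set: int]) a k `^ q.
Proof.
move=> /andP[q0 q1] a0; have qN0 : (q != 0)%R by rewrite gt_eqF.
rewrite -[leRHS](poweRVK qN0); last by apply: esum_ge0 => k _; exact: poweR_ge0.
apply: le_poweR; [exact: ltW|exact: esum_ge0|].
have := @esum_poweR_le q^-1 (fun k => a k `^ q).
rewrite invf_ge1// => /(_ q1 (fun k => poweR_ge0 _ _)).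
by under eq_esum do rewrite poweRK//.
Qed.

End powR_sums.

(** * Jensen's and Minkowski's integral inequalities *)

Section minkowski_integral.
Context {R : realType}.

(** A convex function lies above its tangent at m. For q > 1 this is Young's inequality for g and
    m^(q-1), with conjugate exponents q and q/(q-1). *)
Lemma tangent_powR (q m g : R) : 1 <= q -> 0 <= m -> 0 <= g ->
  q * m `^ (q - 1) * g <= g `^ q + (q - 1) * m `^ q.
Proof.
move=> q1 m0 g0; have q0 : 0 < q by rewrite (lt_le_trans _ q1).
move: q1; rewrite le_eqVlt => /predU1P[<-|q1].
  by rewrite subrr powRr0 powRr1// mul0r addr0 !mul1r.
have q10 : 0 < q - 1 by rewrite subr_gt0.
have := @conjugate_powR R g (m `^ (q - 1)) q (q / (q - 1)) g0 (powR_ge0 _ _) q0.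
rewrite divr_gt0// => /(_ isT); rewrite -powRrM mulrCA divff ?gt_eqF// mulr1.
have -> : q^-1 + (q / (q - 1))^-1 = 1 by field; rewrite ?gt_eqF.
move=> /(_ erefl) h; rewrite -mulrA [m `^ (q - 1) * g]mulrC.
rewrite -(ler_pM2l q0) in h; apply: (le_trans h).
rewrite le_eqVlt; apply/orP; left; apply/eqP.
by field; rewrite ?gt_eqF.
Qed.

Local Open Scope ereal_scope.

(* [tangent_powR] at g = f / w, multiplied by w. *)
Lemma weighted_tangent_poweR (q m w : R) (f : \bar R) : (1 <= q)%R -> (0 <= m)%R ->
  (0 < w)%R -> 0 <= f ->
  (q * m `^ (q - 1))%:E * f <=
    f `^ q * (w `^ (1 - q))%:E + ((q - 1) * m `^ q)%:E * w%:E.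
Proof.
move=> q1 m0 w0; have q0 : (0 < q)%R by rewrite (lt_le_trans _ q1).
case: f => [f f0|_|//]; last first.
  rewrite poweRyr ?gt_eqF// gt0_mulye ?lte_fin ?powR_gt0// addye ?leey//.
have {}f0 : (0 <= f)%R by [].
rewrite poweR_EFin -!EFinM -EFinD lee_fin.
have h := @tangent_powR q m (f / w) q1 m0 (divr_ge0 f0 (ltW w0)).
rewrite -(ler_pM2r w0) in h.
have -> : (q * m `^ (q - 1) * f = q * m `^ (q - 1) * (f / w) * w)%R.
  by rewrite -[RHS]mulrA divfK ?gt_eqF.
apply: (le_trans h); rewrite mulrDl lerD2r powRM ?invr_ge0 ?(ltW w0)//.
rewrite -mulrA ler_wpM2l ?powR_ge0// -powR_inv1 ?(ltW w0)// -powRrM.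
rewrite -{2}(@powRr1 _ w) ?(ltW w0)// -powRD ?mulN1r 1?addrC//.
by apply/implyP => _; rewrite gt_eqF.
Qed.

Context d1 (X : measurableType d1) d2 (Y : measurableType d2).
Variable mX : {sigma_finite_measure set X -> \bar R}.
Variable mY : {sigma_finite_measure set Y -> \bar R}.

(** The weighted tangent inequality is integrated in y with m left free ([key]), and m is optimized
    afterwards. The constant J is any positive bound for the integral of w, so that the lemma can
    still be used when Minkowski's right-hand side is 0. *)
Lemma weighted_jensen (D : set Y) (q J : R) (w : Y -> R) (f : Y -> \bar R) :
  measurable D -> (1 <= q)%R -> (0 < J)%R ->
  measurable_fun D w -> measurable_fun D f ->
  (forall y, D y -> (0 < w y)%R) -> (forall y, D y -> 0 <= f y) ->
  \int[mY]_(y in D) (w y)%:E <= J%:E ->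
  (\int[mY]_(y in D) f y) `^ q <=
    (J `^ (q - 1))%:E * \int[mY]_(y in D) (f y `^ q * (w y `^ (1 - q))%:E).
Proof.
move=> mD q1 J0 mw mf w0 f0 wJ; have q0 : (0 < q)%R by rewrite (lt_le_trans _ q1).
set B := integral _ _ (fun y => f y `^ q * _).
have mfw : measurable_fun D (fun y => f y `^ q * (w y `^ (1 - q))%:E).
  apply: emeasurable_funM; first exact: (measurableT_comp (measurable_poweR q)).
  by apply/measurable_EFinP; exact: (measurableT_comp (measurable_powR (1 - q))).
have fw0 y : D y -> 0 <= f y `^ q * (w y `^ (1 - q))%:E.
  by move=> Dy; rewrite mule_ge0 ?poweR_ge0// lee_fin powR_ge0.
have key (m : R) : (0 <= m)%R -> (q * m `^ (q - 1))%:E * \int[mY]_(y in D) f y <=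
    B + ((q - 1) * m `^ q)%:E * J%:E.
  move=> m0; rewrite -ge0_integralZl//; last first.
    by rewrite lee_fin mulr_ge0 ?powR_ge0 ?(ltW q0).
  have q1m : (0 <= (q - 1) * m `^ q)%R by rewrite mulr_ge0 ?powR_ge0// subr_ge0.
  apply: (@le_trans _ _ (\int[mY]_(y in D) (f y `^ q * (w y `^ (1 - q))%:E +
      ((q - 1) * m `^ q)%:E * (w y)%:E))).
    apply: ge0_le_integral => //.
    - by move=> y Dy; rewrite mule_ge0 ?f0// lee_fin mulr_ge0 ?powR_ge0 ?(ltW q0).
    - exact: measurable_funeM.
    - by apply: emeasurable_funD => //; apply: measurable_funeM; exact/measurable_EFinP.
    - by move=> y Dy; apply: weighted_tangent_poweR => //; [exact: w0|exact: f0].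
  rewrite ge0_integralD//; last 2 first.
    - by move=> y Dy; rewrite mule_ge0// lee_fin ltW// w0.
    - by apply: measurable_funeM; exact/measurable_EFinP.
  rewrite ge0_integralZl//; last 2 first.
    - exact/measurable_EFinP.
    - by move=> y Dy; rewrite lee_fin ltW// w0.
  by rewrite leeD2l// lee_wpmul2l.
have I0 : 0 <= \int[mY]_(y in D) f y by exact: integral_ge0.
have B0 : 0 <= B by exact: integral_ge0.
have [Ioo|Ioo] := eqVneq (\int[mY]_(y in D) f y) +oo.
  (* Any m > 0 would do here: an infinite left-hand side forces B = +oo. *)
  have := key 1%R ler01; rewrite Ioo powR1 mulr1 gt0_muley ?lte_fin// leye_eq.
  rewrite -EFinM.
  have [->|Boo] := eqVneq B +oo; first by rewrite gt0_muley ?leey// lte_fin powR_gt0.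
  have Bfin : B \is a fin_num by rewrite ge0_fin_numE// ltey.
  by rewrite -(fineK Bfin).
have Ifin : \int[mY]_(y in D) f y \is a fin_num by rewrite ge0_fin_numE// ltey.
rewrite -(fineK Ifin); rewrite -(fineK Ifin) in key; set I := fine _ in key *.
have {}I0 : (0 <= I)%R by rewrite /I fine_ge0.
have [Boo|Boo] := eqVneq B +oo.
  by rewrite Boo gt0_muley ?leey// lte_fin powR_gt0.
have Bfin : B \is a fin_num by rewrite ge0_fin_numE// ltey.
(* For q > 1, m = I / J maximizes q m^(q-1) I - (q-1) m^q J, and the maximum is J (I/J)^q. *)
have := key (I / J)%R; rewrite divr_ge0 ?(ltW J0)// => /(_ isT).
rewrite -(fineK Bfin); set b := fine B.
rewrite poweR_EFin -!EFinM -EFinD !lee_fin => h.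
have {}h : (J * (I / J) `^ q <= b)%R.
  have E : ((I / J) `^ (q - 1) * I = (I / J) `^ q * J)%R.
    have [->|IN0] := eqVneq I 0%R.
      by rewrite mul0r mulr0 powR0 ?gt_eqF// mul0r.
    rewrite -{2}(divfK (lt0r_neq0 J0) I) mulrA; congr (_ * _)%R.
    rewrite -{2}(@powRr1 _ (I / J)) ?divr_ge0 ?(ltW J0)// -powRD ?subrK//.
    by rewrite (gt_eqF q0).
  move: h; rewrite -mulrA E; nra.
have -> : (I `^ q = J `^ (q - 1) * (J * (I / J) `^ q))%R.
  have -> : (I = J * (I / J))%R by field; rewrite gt_eqF.
  rewrite powRM ?divr_ge0 ?(ltW J0)// mulrA; congr (_ * _)%R; last first.
    by rewrite mulrAC divff ?mul1r ?gt_eqF.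
  rewrite -{3}(@powRr1 _ J) ?(ltW J0)// -powRD ?subrK//.
  by apply/implyP => _; rewrite gt_eqF.
by rewrite ler_wpM2l ?powR_ge0.
Qed.

(* With W y the L^q norm of the slice f (., y), Jensen's inequality for the
   measure W mY bounds (int f (x, y) dy)^q by I^(q-1) int f^q W^(1-q) dy, where
   I = int W; Tonelli's theorem concludes. The y where W y is 0 or +oo are
   removed first. *)
Lemma minkowski_integral (q : R) (f : X * Y -> \bar R) : (1 <= q)%R ->
  measurable_fun [set: X * Y] f -> (forall z, 0 <= f z) ->
  \int[mX]_x (\int[mY]_y f (x, y)) `^ q <=
    (\int[mY]_y (\int[mX]_x (f (x, y) `^ q)) `^ q^-1) `^ q.
Proof.
move=> q1 mf f0; have q0 : (0 < q)%R by rewrite (lt_le_trans _ q1).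
have qN0 : (q != 0)%R by rewrite gt_eqF.
pose fq z := f z `^ q.
have mfq : measurable_fun [set: X * Y] fq.
  exact: (measurableT_comp (measurable_poweR q)).
have fq0 z : 0 <= fq z by exact: poweR_ge0.
pose V y := \int[mX]_x fq (x, y).
have mV : measurable_fun [set: Y] V by exact: measurable_fun_fubini_tonelli_G.
have V0 y : 0 <= V y by exact: integral_ge0.
pose W y := V y `^ q^-1.
have mW : measurable_fun [set: Y] W.
  exact: (measurableT_comp (measurable_poweR q^-1)).
have W0 y : 0 <= W y by exact: poweR_ge0.
rewrite -/(integral mY setT W); set I := integral _ _ W.
have I0 : 0 <= I by apply: integral_ge0 => y _; exact: W0.
have [->|Ioo] := eqVneq I +oo; first by rewrite poweRyr// leey.
pose D : set Y := W @^-1` [set` `]0%E, +oo%E[].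
have mD : measurable D.
  by rewrite -[D]setTI; apply: mW => //; exact: emeasurable_itv.
pose fD z := f z * (\1_D z.2)%:E.
pose fN z := f z * (\1_(~` D) z.2)%:E.
have mfE (E : set Y) : measurable E ->
    measurable_fun [set: X * Y] (fun z => f z * (\1_E z.2)%:E).
  move=> mE; apply: emeasurable_funM => //; apply/measurable_EFinP.
  exact: (measurableT_comp (measurable_indic mE)).
have fE0 (E : set Y) z : 0 <= f z * (\1_E z.2)%:E.
  by rewrite mule_ge0// lee_fin.
have mfN : measurable_fun [set: X * Y] fN := mfE _ (measurableC mD).
have mfD : measurable_fun [set: X * Y] fD := mfE _ mD.
(* The removed part carries no mass: if W y = 0, the slice f (., y) vanishes almost everywhere, and
   W y = +oo only on a null set because I is finite. *)
have fN_eq0 : \int[mX]_x \int[mY]_y fN (x, y) = 0.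
  rewrite (fubini_tonelli fN mfN (fE0 _)).
  rewrite -[RHS](integral0 mY [set: Y]); apply: ge0_ae_eq_integral => //.
  - apply: (measurable_fun_fubini_tonelli_G fN); last exact: fE0.
    exact: mfN.
  - by move=> y _; apply: integral_ge0 => x _; exact: fE0.
  have : mY.-integrable [set: Y] W.
    apply/integrableP; split => //.
    under eq_integral do rewrite gee0_abs//.
    by rewrite ltey.
  move/(integrable_ae measurableT); apply: filterS => y /(_ Logic.I) Wfin _.
  rewrite /fN /=; under eq_integral do rewrite muleC.
  rewrite ge0_integralZl//; last exact: (measurable_fun_pair1 y mf).
  have [Dy|Dy] := pselect (D y).
    by rewrite indicE memNset ?mul0e//; apply.
  have V_eq0 : V y = 0.
    apply: (@poweR_eq0_eq0 _ _ q^-1) => //; apply/eqP; rewrite eq_le W0 andbT leNgt.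
    by apply/negP => Wy; apply: Dy; rewrite /D /= in_itv/= Wy ltey_eq Wfin.
  suff -> : \int[mX]_x f (x, y) = 0 by rewrite mule0.
  have : \int[mX]_x `|fq (x, y)| = 0.
    by rewrite -V_eq0; apply: eq_integral => x _; rewrite gee0_abs.
  move/(ae_eq_integral_abs mX measurableT (measurable_fun_pair1 y mfq)) => h.
  rewrite -[RHS](integral0 mX [set: X]); apply: ge0_ae_eq_integral => //.
    exact: (measurable_fun_pair1 y mf).
  by apply: filterS h => x /(_ Logic.I) h _; exact: (poweR_eq0_eq0 (f0 _) h).
have -> : \int[mX]_x (\int[mY]_y f (x, y)) `^ q =
          \int[mX]_x (\int[mY]_y fD (x, y)) `^ q.
  apply: ge0_ae_eq_integral => //.
  - apply: (measurableT_comp (measurable_poweR q)).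
    exact: measurable_fun_fubini_tonelli_F.
  - apply: (measurableT_comp (measurable_poweR q)).
    by apply: measurable_fun_fubini_tonelli_F; [exact: mfD|exact: fE0].
  - by move=> x _; exact: poweR_ge0.
  - by move=> x _; exact: poweR_ge0.
  have : \int[mX]_x `|\int[mY]_y fN (x, y)| = 0.
    rewrite -[RHS]fN_eq0; apply: eq_integral => x _; rewrite gee0_abs//.
    by apply: integral_ge0 => y _; exact: fE0.
  have mN : measurable_fun [set: X] (fun x => \int[mY]_y fN (x, y)).
    apply: (measurable_fun_fubini_tonelli_F fN); last exact: fE0.
    exact: mfN.
  move/(ae_eq_integral_abs mX measurableT mN); apply: filterS => x /(_ Logic.I) h _.
  congr (_ `^ q); transitivity (\int[mY]_y fD (x, y) + \int[mY]_y fN (x, y)); last first.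
    by rewrite h /cst adde0.
  rewrite -ge0_integralD//; last 4 first.
  - by move=> y _; exact: fE0.
  - exact: (measurable_fun_pair2 x mfD).
  - by move=> y _; exact: fE0.
  - exact: (measurable_fun_pair2 x mfN).
  apply: eq_integral => y _; rewrite /fD /fN/= -ge0_muleDr ?lee_fin//.
  by rewrite !indicE in_setC; case: (y \in D); rewrite /= ?adde0 ?add0e mule1.
(* Stated for every positive J >= I, since I itself may be 0. The integral of g over X is W^(1-q)
   W^q = W on D, hence at most I in total. *)
have main (J : R) : (0 < J)%R -> I <= J%:E ->
    \int[mX]_x (\int[mY]_y fD (x, y)) `^ q <= (J `^ q)%:E.
  move=> J0 IJ.
  pose w y := fine (W y).
  have mw : measurable_fun [set: Y] w by exact: measurableT_comp.
  pose g z := (w z.2 `^ (1 - q) * \1_D z.2)%:E * fq z.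
  have mg : measurable_fun [set: X * Y] g.
    apply: emeasurable_funM => //; apply/measurable_EFinP; apply: measurable_funM.
      apply: (measurableT_comp (measurable_powR (1 - q))).
      exact: (measurableT_comp mw).
    exact: (measurableT_comp (measurable_indic mD)).
  have g0 z : 0 <= g z by rewrite mule_ge0// lee_fin mulr_ge0 ?powR_ge0.
  apply: (@le_trans _ _ ((J `^ (q - 1))%:E * \int[mX]_x \int[mY]_y g (x, y))).
    rewrite -ge0_integralZl//; last 3 first.
    - exact: measurable_fun_fubini_tonelli_F.
    - by move=> x _; apply: integral_ge0.
    - by rewrite lee_fin powR_ge0.
    apply: ge0_le_integral => //.
    - by move=> x _; exact: poweR_ge0.
    - apply: (measurableT_comp (measurable_poweR q)).
      by apply: measurable_fun_fubini_tonelli_F; [exact: mfD|exact: fE0].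
    - by apply: measurable_funeM; exact: measurable_fun_fubini_tonelli_F.
    move=> x _.
    have := @weighted_jensen D q J w (fun y => f (x, y)) mD q1 J0.
    have -> : \int[mY]_y fD (x, y) = \int[mY]_(y in D) f (x, y).
      by rewrite [RHS]integral_mkcond epatch_indic.
    have -> : \int[mY]_y g (x, y) =
        \int[mY]_(y in D) (f (x, y) `^ q * (w y `^ (1 - q))%:E).
      rewrite [RHS]integral_mkcond epatch_indic; apply: eq_integral => y _.
      by rewrite /g/= EFinM [RHS]muleAC [RHS]muleC [X in _ = _ * X]muleC muleA.
    apply => //.
    - exact: measurable_funTS.
    - exact: (measurable_funTS (measurable_fun_pair2 x mf)).
    - by move=> y; rewrite /D/= in_itv/= => /andP[Wy Wyoo]; rewrite fine_gt0// Wy.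
    apply: le_trans IJ; rewrite /I.
    apply: (@le_trans _ _ (\int[mY]_(y in D) W y)); last first.
      exact: ge0_subset_integral.
    rewrite le_eqVlt; apply/orP; left; apply/eqP; apply: eq_integral => y.
    by rewrite inE /D/= in_itv/= => /andP[Wy Wyoo]; rewrite fineK// ge0_fin_numE.
  rewrite fubini_tonelli//.
  have -> : (J `^ q)%:E = (J `^ (q - 1))%:E * J%:E.
    rewrite -EFinM -{3}(@powRr1 _ J) ?(ltW J0)// -powRD ?subrK//.
    by rewrite (gt_eqF q0).
  rewrite lee_wpmul2l// ?lee_fin ?powR_ge0//; apply: le_trans IJ.
  apply: ge0_le_integral => //.
  - by move=> y _; apply: integral_ge0.
  - exact: measurable_fun_fubini_tonelli_G.
  move=> y _; rewrite /g/= ge0_integralZl//; last 2 first.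
  - exact: (measurable_fun_pair1 y mfq).
  - by rewrite lee_fin mulr_ge0 ?powR_ge0.
  rewrite -/(V y) indicE; have [|Dy] := boolP (y \in D); last by rewrite mulr0 mul0e W0.
  rewrite inE /D/= in_itv/= => /andP[Wy Wyoo]; rewrite mulr1.
  have w0 : (0 < w y)%R by rewrite fine_gt0// Wy.
  have WE : W y = (w y)%:E by rewrite fineK// ge0_fin_numE.
  have VE : V y = (w y `^ q)%:E by rewrite -(poweRVK qN0 (V0 y)) -/(W y) WE.
  rewrite -/(W y) WE VE -EFinM lee_fin -powRD ?subrK ?powRr1 ?(ltW w0)//.
  by rewrite oner_eq0.
have [I00|IN0] := eqVneq I 0.
  (* J = e^(1/q) turns the bound J^q into the arbitrary e > 0. *)
  rewrite I00 poweR0r//; apply/lee_addgt0Pr => e e0; rewrite add0e.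
  have := main (e `^ q^-1)%R; rewrite powR_gt0// => /(_ isT).
  by rewrite I00 lee_fin powR_ge0 -powRrM mulVf// powRr1 ?(ltW e0)//; apply.
have Ifin : I \is a fin_num by rewrite ge0_fin_numE// ltey.
rewrite -(fineK Ifin) poweR_EFin; apply: main; last by rewrite fineK.
by rewrite fine_gt0// lt0e IN0 I0 ltey.
Qed.

End minkowski_integral.

(** * The layer-cake formula for powers *)

Section layer_cake.
Context {R : realType}.

Lemma continuous_powR (r x : R) : 0 < x -> {for x, continuous (fun l : R => l `^ r)}.
Proof.
move=> x0; apply: differentiable_continuous; apply/derivable1_diffP.
by apply: derivable_powR; rewrite in_itv/= x0.
Qed.

(** The case r = 0 counts: the density r l^(r-1) with r = 1 is constant, in accordance with the
    convention 0^0 = 1. *)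
Lemma continuous_at_right_powR (r : R) : 0 <= r ->
  (l : R) `^ r @[l --> 0^'+] --> (0 : R) `^ r.
Proof.
rewrite le_eqVlt => /predU1P[<-|r0]; last by rewrite powR0 ?gt_eqF//; exact: powR_cvg0.
by under eq_fun do rewrite powRr0; rewrite powRr0; exact: cvg_cst.
Qed.

Local Open Scope ereal_scope.

Lemma integral_powR (r c : R) : (1 <= r)%R -> (0 <= c)%R ->
  \int[lebesgue_measure]_(l in `]0%R, c[) (r * l `^ (r - 1))%:E = (c `^ r)%:E.
Proof.
move=> r1; have r0 : (0 < r)%R by rewrite (lt_le_trans _ r1).
rewrite le_eqVlt => /predU1P[<-|c0].
  by rewrite set_itvoo0 integral_set0 powR0 ?gt_eqF.
have mf : measurable_fun [set: R] (fun l : R => r * l `^ (r - 1))%R.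
  by apply: measurable_funM => //; exact: measurable_powR.
rewrite integral_itv_bndo_bndc; last exact/measurable_EFinP/measurable_funTS.
rewrite integral_itv_obnd_cbnd; last exact/measurable_EFinP/measurable_funTS.
rewrite (@continuous_FTC2 _ _ (fun l => l `^ r)%R)//.
- by rewrite powR0 ?gt_eqF// sube0.
- apply/continuous_within_itvP => //; split.
  + move=> x; rewrite in_itv/= => /andP[x0 _].
    by apply: cvgM; [exact: cvg_cst|exact: continuous_powR].
  + apply: cvgM; first exact: cvg_cst.
    by apply: continuous_at_right_powR; rewrite subr_ge0.
  + apply: cvgM; first exact: cvg_cst.
    by apply: cvg_at_left_filter; exact: continuous_powR.
- split.
  + by move=> x; rewrite in_itv/= => /andP[x0 _]; apply: derivable_powR; rewrite in_itv/= x0.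
  + exact/continuous_at_right_powR/ltW.
  + by apply: cvg_at_left_filter; exact: continuous_powR.
- move=> x; rewrite in_itv/= => /andP[x0 _].
  by rewrite powR_derive1// in_itv/= x0.
Qed.

(** The density of d(l^r) on the half-line, extended by 0 to all of R so that Tonelli and Minkowski
    apply on the full product space. *)
Definition layer_weight (r l : R) : R := (r * l `^ (r - 1) * \1_(`]0%R, +oo[ : set R) l)%R.

Lemma layer_weight_ge0 (r l : R) : (0 <= r)%R -> (0 <= layer_weight r l)%R.
Proof.
move=> r0; by rewrite /layer_weight mulr_ge0 ?mulr_ge0 ?powR_ge0.
Qed.

Lemma measurable_layer_weight (r : R) : measurable_fun [set: R] (layer_weight r).
Proof.
apply: measurable_funM; last by apply: measurable_indic; exact: measurable_itv.
by apply: measurable_funM => //; exact: measurable_powR.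
Qed.

Lemma integral_layer_weight (r c : R) : (1 <= r)%R -> (0 <= c)%R ->
  \int[lebesgue_measure]_l ((layer_weight r l)%:E * (\1_[set l | (l < c)%R] l)%:E) =
  (c `^ r)%:E.
Proof.
move=> r1 c0; rewrite -(integral_powR r1 c0) [RHS]integral_mkcond epatch_indic.
apply: eq_integral => l _; rewrite /layer_weight -!EFinM !indicE; congr (_%:E).
have -> : (l \in [set l | (l < c)%R]) = (l < c)%R by apply/idP/idP; rewrite inE.
by rewrite !mem_setE !in_itv/= andbT; case: (0 < l)%R; rewrite ?mulr1 ?mulr0 ?mul0r.
Qed.

End layer_cake.

(** * Geometric sums over sets of integers *)

Section geometric_sums.
Context {R : realType}.
Local Open Scope ereal_scope.

Let t (theta : R) (k : int) : R := (2 `^ (- (k%:~R * theta)))%R.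

Let t_gt0 theta k : (0 < t theta k)%R.
Proof. by rewrite /t powR_gt0. Qed.

(** For theta > 0 the condition t_k <= M describes a half-line k >= k0. The sum over it is a
    geometric series of ratio z = 2^(-theta alpha) whose first term is at most M^alpha, whence K =
    1/(1 - z). *)
Let esum_geometric_gt0 (theta alpha : R) : (0 < theta)%R -> (0 < alpha)%R ->
  exists2 K : R, (0 < K)%R & forall (M : R) (S : set int), (0 <= M)%R ->
    (forall k, S k -> t theta k <= M)%R ->
    \esum_(k in [set: int]) (t theta k `^ alpha * \1_S k)%:E <= (K * M `^ alpha)%:E.
Proof.
move=> theta0 alpha0; pose z : R := (2 `^ (- (theta * alpha)))%R.
have z0 : (0 < z)%R by rewrite powR_gt0.
have ln2 : (0 < ln 2 :> R)%R by rewrite ln_gt0// ltr1n.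
have z1 : (z < 1)%R.
  rewrite /z /powR gt_eqF// -[ltRHS]expR0 ltr_expR mulNr oppr_lt0.
  by rewrite !mulr_gt0.
exists (1 - z)^-1%R; first by rewrite invr_gt0 subr_gt0.
move=> M S M0 SM.
have K0 : (0 <= (1 - z)^-1)%R by rewrite invr_ge0 subr_ge0 ltW.
(* M = 0 leaves S empty, because every t_k is positive; otherwise ln M makes sense. *)
have [{}M0|M_gt0] := leP M 0%R.
  rewrite esum1 ?lee_fin ?mulr_ge0 ?powR_ge0// => k _.
  rewrite indicE memNset ?mulr0// => /SM.
  by apply/negP; rewrite -ltNge (le_lt_trans M0).
pose k0 := Num.ceil (- ln M / (theta * ln 2))%R.
have tM k : (t theta k <= M)%R = (k0 <= k)%R.
  rewrite ceil_le_int ler_pdivrMr ?mulr_gt0// lerNl.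
  rewrite /t /powR ?gt_eqF// -[in LHS](lnK M_gt0) ler_expR.
  by rewrite mulNr mulrA.
apply: (@le_trans _ _ (\esum_(k in [set k | (k0 <= k)%R]) (t theta k `^ alpha)%:E)).
  rewrite [leRHS]esum_mkcond; apply: le_esum => k _.
  rewrite indicE; have [kS|kS] := boolP (k \in S).
    by rewrite mulr1 ifT// inE/= -tM; apply: SM; rewrite -inE.
  by rewrite mulr0; case: ifPn => // _; rewrite lee_fin powR_ge0.
rewrite (reindex_esum [set: nat] _ (fun n : nat => k0 + n%:Z)%R); last first.
  split.
  - by move=> n _ /=; lia.
  - by move=> m n _ _ /addrI [].
  - move=> k /= k0k; exists `|k - k0|%N => //.
    lia.
rewrite -nneseries_esumT; last by move=> n; rewrite lee_fin powR_ge0.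
apply: lime_le; first by apply: is_cvg_nneseries => n _ _; rewrite lee_fin powR_ge0.
apply: nearW => n; rewrite sumEFin lee_fin.
have -> : (\sum_(0 <= i < n) t theta (k0 + i%:Z)%R `^ alpha)%R =
    series (geometric (t theta k0 `^ alpha) z) n.
  rewrite /series/=; apply: eq_bigr => i _; rewrite /t /z -!powRrM -powR_mulrn ?powR_ge0//.
  rewrite -powRrM -powRD; last by rewrite pnatr_eq0 implybT.
  by congr (_ `^ _)%R; rewrite rmorphD/= pmulrn; ring.
apply: le_trans (geometric_le_lim _ _ z0 _) _; first exact: powR_ge0.
  by rewrite gtr0_norm.
rewrite mulrC; apply: ler_wpM2l => //.
by apply: ge0_ler_powR; rewrite ?nnegrE ?tM//; [exact: ltW|exact/ltW/t_gt0].
Qed.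

Lemma esum_geometric_le (theta alpha : R) : (theta != 0)%R -> (0 < alpha)%R ->
  exists2 K : R, (0 < K)%R & forall (M : R) (S : set int), (0 <= M)%R ->
    (forall k, S k -> 2 `^ (- (k%:~R * theta)) <= M)%R ->
    \esum_(k in [set: int]) ((2 `^ (- (k%:~R * theta))) `^ alpha * \1_S k)%:E <=
      (K * M `^ alpha)%:E.
Proof.
move=> thetaN0 alpha0; have [|theta0] := leP theta 0%R; last exact: esum_geometric_gt0.
rewrite le_eqVlt (negbTE thetaN0)/= -oppr_gt0 => theta0.
have [K K0 HK] := esum_geometric_gt0 theta0 alpha0.
exists K => // M S M0 SM.
(* A negative theta becomes positive under k -> -k. *)
rewrite (reindex_esum [set: int] _ (fun k : int => - k)%R); last first.
  split; [by []|by move=> k l _ _ /oppr_inj|].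
  by move=> k _; exists (- k)%R => //; rewrite opprK.
have tN k : t (- theta) k = t theta (- k) by rewrite /t rmorphN/= mulrN mulNr.
apply: le_trans (HK M [set k | S (- k)%R] M0 _); last by move=> k /SM; rewrite tN.
apply: le_esum => k _; rewrite -/(t theta (- k)) -tN.
suff -> : \1_S (- k)%R = \1_[set k | S (- k)%R] k :> R by [].
by rewrite !indicE; congr ((nat_of_bool _)%:R); apply/idP/idP; rewrite !inE.
Qed.

(** If B is the sum of the t_k^beta over S, each t_k with k in S is at most M = B^(1/beta), so the
    sum of the t_k^alpha is at most K B^(alpha/beta). The exponents are in no particular order: (p,
    r) and (r, p) are both used, which gives the two directions of (ii). *)
Lemma esum_geometric_power (theta alpha beta : R) : (theta != 0)%R ->
  (0 < alpha)%R -> (0 < beta)%R ->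
  exists2 K : R, (0 < K)%R & forall S : set int,
    (\esum_(k in [set: int]) ((2 `^ (- (k%:~R * theta))) `^ alpha * \1_S k)%:E)
      `^ (beta / alpha) <=
    K%:E * \esum_(k in [set: int]) ((2 `^ (- (k%:~R * theta))) `^ beta * \1_S k)%:E.
Proof.
move=> theta0 alpha0 beta0; have [K K0 HK] := esum_geometric_le theta0 alpha0.
exists (K `^ (beta / alpha))%R; first by rewrite powR_gt0.
move=> S; set B := (X in _ <= _ * X).
have term_ge0 gamma k : 0 <= (t theta k `^ gamma * \1_S k)%:E.
  by rewrite lee_fin mulr_ge0 ?powR_ge0.
have B0 : 0 <= B by apply: esum_ge0 => k _; exact: term_ge0.
have [->|Boo] := eqVneq B +oo.
  by rewrite gt0_muley ?leey// lte_fin powR_gt0.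
have Bfin : B \is a fin_num by rewrite ge0_fin_numE// ltey.
have betaN0 : (beta != 0)%R by rewrite gt_eqF.
pose M := (fine B `^ beta^-1)%R.
have HM k : S k -> (t theta k <= M)%R.
  move=> Sk; have : (t theta k `^ beta <= fine B)%R.
    rewrite -lee_fin fineK//; have := le_esum_term k (term_ge0 beta).
    by rewrite indicE mem_set// mulr1.
  move=> h; have := @ge0_ler_powR R beta^-1 _ _ _ _ _ h.
  rewrite invr_ge0 ltW// !nnegrE powR_ge0 fine_ge0// => /(_ isT isT isT).
  by rewrite -powRrM divff// powRr1// ltW.
have := HK M S (powR_ge0 _ _) HM.
move=> /(@le_poweR _ (beta / alpha)) h; apply: le_trans (h _ _) _.
- by rewrite divr_ge0 ?ltW.
- by apply: esum_ge0 => k _; exact: term_ge0.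
rewrite poweR_EFin -(fineK Bfin) -EFinM lee_fin powRM ?powR_ge0 ?(ltW K0)//.
rewrite /M -!powRrM mulrA [(beta^-1 * _)%R]mulrC.
have -> : (alpha * beta^-1 * (beta / alpha) = 1)%R.
  by field; rewrite betaN0 gt_eqF.
by rewrite powRr1 ?fine_ge0.
Qed.

End geometric_sums.

(** * Superlevel sets of the rescaled pieces *)

Section level_sets.
Context {R : realType} d (T : measurableType d).
Variable mu : {sigma_finite_measure set T -> \bar R}.
Variables (p gamma : R) (a : int -> T -> R).
Hypothesis p_gt0 : 0 < p.
Hypothesis a_ge0 : forall k x, 0 <= a k x.
Hypothesis measurable_a : forall k, measurable_fun [set: T] (a k).
Local Open Scope ereal_scope.

Let t (k : int) : R := (2 `^ (- (k%:~R * (gamma / p))))%R.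

Let t_gt0 k : (0 < t k)%R.
Proof. by rewrite /t powR_gt0. Qed.

Definition scaled (k : int) (x : T) : R := (2 `^ (k%:~R * (gamma / p)) * a k x)%R.

Let scaledE k x : scaled k x = (a k x / t k)%R.
Proof. by rewrite /scaled /t powRN invrK mulrC. Qed.

Let scaled_ge0 k x : (0 <= scaled k x)%R.
Proof. by rewrite /scaled mulr_ge0 ?powR_ge0. Qed.

Definition superlevel (l : R) (x : T) : set int := [set k | (l < scaled k x)%R].

(** For b = p this is the G(l, x) of the overview, as t_k^p = 2^(-k gamma); for b = r it is the sum
    to which G^(r/p) is compared. *)
Definition level_sum (b l : R) (x : T) : \bar R :=
  \esum_(k in [set: int]) (t k `^ b * \1_(superlevel l x) k)%:E.

Definition mixed_distr (l : R) : \bar R :=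
  \esum_(k in [set: int])
    (2 `^ (- (k%:~R * gamma)))%:E * mu [set x | (l < scaled k x)%R].

Lemma measurable_scaled k : measurable_fun [set: T] (scaled k).
Proof. exact: measurable_funM. Qed.

Let level_term_ge0 b l x k : 0 <= (t k `^ b * \1_(superlevel l x) k)%:E.
Proof. by rewrite lee_fin mulr_ge0 ?powR_ge0. Qed.

Lemma level_sum_ge0 b l x : 0 <= level_sum b l x.
Proof. by apply: esum_ge0 => k _; exact: level_term_ge0. Qed.

Lemma measurable_superlevel (k : int) : measurable_fun [set: measurableTypeR R * T]
  (fun z => \1_(superlevel z.1 z.2) k : R).
Proof.
have mlt : measurable_fun [set: measurableTypeR R * T]
    (fun z => (z.1 < scaled k z.2)%R).
  apply: measurable_fun_ltr; first exact: measurable_fst.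
  exact: (measurableT_comp (measurable_scaled k) measurable_snd).
have mA : measurable [set z : measurableTypeR R * T | (z.1 < scaled k z.2)%R].
  by move: mlt => /(_ measurableT [set true]); rewrite setTI preimage_true; exact.
have := @measurable_indic _ _ R setT _ mA; apply: eq_measurable_fun => z _.
by rewrite !indicE; congr ((nat_of_bool _)%:R); apply/idP/idP; rewrite !inE.
Qed.

Lemma measurable_level_sum b : measurable_fun [set: measurableTypeR R * T]
  (fun z => level_sum b z.1 z.2).
Proof.
apply: measurable_esum_int => [k|k z]; last exact: level_term_ge0.
by apply/measurable_EFinP/measurable_funM => //; exact: measurable_superlevel.
Qed.

Lemma integral_level_sum l : \int[mu]_x level_sum p l x = mixed_distr l.
Proof.
have mlevel k : measurable [set x | (l < scaled k x)%R].
  have := measurable_fun_ltr (@measurable_cst _ _ _ _ setT l) (measurable_scaled k).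
  by move=> /(_ measurableT [set true]); rewrite setTI preimage_true; exact.
have E k : (fun x => (t k `^ p * \1_(superlevel l x) k)%:E) =
    (fun x => (2 `^ (- (k%:~R * gamma)))%:E * (\1_[set x | (l < scaled k x)%R] x)%:E).
  apply/funext => x; rewrite -EFinM; congr ((_ * _)%:E).
  by rewrite /t -powRrM mulNr -mulrA divfK ?gt_eqF.
have mI k : measurable_fun [set: T] (fun x => (\1_[set x | (l < scaled k x)%R] x)%:E : \bar R).
  exact/measurable_EFinP/measurable_indic.
rewrite integral_esum_int => [|k|k x]; last exact: level_term_ge0.
  apply: eq_esum => k _; rewrite E ge0_integralZl//.
  by rewrite integral_indic// setIT.
by rewrite E; exact: measurable_funeM.
Qed.

(** Measurability in l comes from Tonelli's theorem for the jointly measurable [level_sum p]. *)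
Lemma measurable_mixed_distr : measurable_fun [set: measurableTypeR R] mixed_distr.
Proof.
have -> : mixed_distr = fun l => \int[mu]_x level_sum p l x.
  by apply/funext => l; rewrite integral_level_sum.
apply: (measurable_fun_fubini_tonelli_F (fun z => level_sum p z.1 z.2)).
  exact: measurable_level_sum.
by move=> z; exact: level_sum_ge0.
Qed.

(** The k-th indicator integrates to scaled_k^r = a_k^r t_k^(-r), and the weight t_k^r cancels the
    second factor, so theta disappears. *)
Lemma integral_layer_weight_level_sum (r : R) x : (1 <= r)%R ->
  \int[lebesgue_measure]_l ((layer_weight r l)%:E * level_sum r l x) =
  \esum_(k in [set: int]) (a k x `^ r)%:E.
Proof.
move=> r1; have r0 : (0 < r)%R by rewrite (lt_le_trans _ r1).
have weight0 l : 0 <= (layer_weight r l)%:E by rewrite lee_fin layer_weight_ge0// ltW.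
have mweight := @measurable_layer_weight R r.
have E k : (fun l => (layer_weight r l)%:E * (t k `^ r * \1_(superlevel l x) k)%:E) =
    (fun l => (t k `^ r)%:E * ((layer_weight r l)%:E * (\1_[set l | (l < scaled k x)%R] l)%:E)).
  apply/funext => l; rewrite [RHS]muleCA.
  rewrite [X in _ * X]EFinM; congr (_ * (_ * _)).
have mI k : measurable_fun [set: measurableTypeR R]
    (fun l => (layer_weight r l)%:E * (\1_[set l | (l < scaled k x)%R] l)%:E).
  apply: emeasurable_funM; first exact/measurable_EFinP.
  apply/measurable_EFinP/measurable_indic.
  have -> : [set l | (l < scaled k x)%R] = `]-oo, scaled k x[%classic.
    by apply/seteqP; split => l /=; rewrite in_itv.
  exact: measurable_itv.
transitivity (\int[lebesgue_measure]_l \esum_(k in [set: int])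
    ((layer_weight r l)%:E * (t k `^ r * \1_(superlevel l x) k)%:E)).
  apply: eq_integral => l _; rewrite esum_intZl//.
  by rewrite layer_weight_ge0// ltW.
rewrite integral_esum_int => [|k|k l].
- apply: eq_esum => k _; rewrite E ge0_integralZl//; last 2 first.
  + by move=> l _; rewrite mule_ge0 ?lee_fin// layer_weight_ge0// ltW.
  + by rewrite lee_fin powR_ge0.
  rewrite integral_layer_weight// -EFinM -powRM ?(ltW (t_gt0 _))// scaledE.
  by rewrite mulrC divfK ?gt_eqF.
- by rewrite E; exact: measurable_funeM.
- by rewrite mule_ge0// lee_fin layer_weight_ge0// ltW.
Qed.

End level_sets.

(** * Comparison with the Triebel-Lizorkin integral for finite r *)

Section mixed_estimates.
Context {R : realType} d (T : measurableType d).
Variable mu : {sigma_finite_measure set T -> \bar R}.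
Variables (p gamma : R).
Hypothesis p_gt0 : 0 < p.
Hypothesis gamma_neq0 : gamma != 0.
Local Open Scope ereal_scope.

Let theta_neq0 : (gamma / p != 0)%R.
Proof. by rewrite mulf_neq0// invr_eq0 gt_eqF. Qed.

Lemma int_mixed_distr_le_esum_pow (r : R) : (1 <= r)%R -> (p <= r)%R ->
  exists2 K : R, (0 < K)%R & forall a : int -> T -> R,
    (forall k x, 0 <= a k x)%R -> (forall k, measurable_fun [set: T] (a k)) ->
    \int[lebesgue_measure]_l ((layer_weight r l)%:E * mixed_distr mu p gamma a l `^ (r / p)) <=
    K%:E * (\int[mu]_x (\esum_(k in [set: int]) (a k x `^ r)%:E) `^ (p / r)) `^ (r / p).
Proof.
move=> r1 pr; have r0 : (0 < r)%R by rewrite (lt_le_trans _ r1).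
have [K K0 HK] := esum_geometric_power theta_neq0 p_gt0 r0.
exists K => // a a0 ma.
pose q := (r / p)%R; pose q' := (p / r)%R.
have q1 : (1 <= q)%R by rewrite /q ler_pdivlMr// mul1r.
have q0 : (0 < q)%R by rewrite divr_gt0.
have q'0 : (0 < q')%R by rewrite divr_gt0.
have qV : (q^-1 = q')%R by rewrite /q invf_div.
have q'q : (q' * q = 1)%R by rewrite -qV mulVf// gt_eqF.
pose A x := \esum_(k in [set: int]) (a k x `^ r)%:E.
have A0 x : 0 <= A x by apply: esum_ge0 => k _; rewrite lee_fin powR_ge0.
have mA : measurable_fun [set: T] A.
  apply: measurable_esum_int => [k|k x]; last by rewrite lee_fin powR_ge0.
  exact/measurable_EFinP/(measurableT_comp (measurable_powR r)).
have weight0 l : (0 <= layer_weight r l)%R by rewrite layer_weight_ge0// ltW.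
have mweight := @measurable_layer_weight R r.
pose G l x := level_sum p gamma a p l x.
have G0 l x : 0 <= G l x by exact: level_sum_ge0.
have mG : measurable_fun [set: measurableTypeR R * T] (fun z => G z.1 z.2).
  exact: measurable_level_sum.
(* The power q' = 1/q is chosen so that f^q carries exactly the density [layer_weight]. *)
pose f (z : measurableTypeR R * T) := (layer_weight r z.1 `^ q')%:E * G z.1 z.2.
have mf : measurable_fun [set: measurableTypeR R * T] f.
  apply: emeasurable_funM => //; apply/measurable_EFinP.
  apply: (measurableT_comp (measurable_powR q')).
  exact: (measurableT_comp mweight measurable_fst).
have f0 z : 0 <= f z by rewrite mule_ge0// lee_fin powR_ge0.
have mGl l : measurable_fun [set: T] (G l) by exact: (measurable_fun_pair2 l mG).
have mSx x : measurable_fun [set: measurableTypeR R]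
    (fun l => (layer_weight r l)%:E * level_sum p gamma a r l x).
  apply: emeasurable_funM; first exact/measurable_EFinP.
  exact: (measurable_fun_pair1 x (measurable_level_sum p gamma ma r)).
have -> : \int[lebesgue_measure]_l ((layer_weight r l)%:E * mixed_distr mu p gamma a l `^ q) =
    \int[lebesgue_measure]_l (\int[mu]_x f (l, x)) `^ q.
  apply: eq_integral => l _; rewrite /f/= ge0_integralZl//; last first.
    by rewrite lee_fin powR_ge0.
  rewrite integral_level_sum// poweRM ?lee_fin ?powR_ge0//; last first.
    by rewrite -integral_level_sum//; apply: integral_ge0.
  by rewrite poweR_EFin -powRrM q'q powRr1.
apply: (le_trans (@minkowski_integral _ _ _ _ _ lebesgue_measure mu q f q1 mf f0)).
(* After Minkowski the integral in l is innermost: G^q <= K [level_sum] with exponent r, and the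
   layer-cake formula integrates the latter to A x. *)
have KA x : (\int[lebesgue_measure]_l (f (l, x) `^ q)) `^ q^-1 <=
    (K `^ q')%:E * A x `^ q'.
  rewrite qV -poweR_EFin -poweRM ?lee_fin ?(ltW K0)//.
  apply: le_poweR; first exact: ltW.
    by apply: integral_ge0 => l _; exact: poweR_ge0.
  rewrite /A -(integral_layer_weight_level_sum p gamma a0 x r1) -ge0_integralZl//.
  - apply: ge0_le_integral => //.
    + by move=> l _; exact: poweR_ge0.
    + apply: (measurableT_comp (measurable_poweR q)).
      exact: (measurable_fun_pair1 x mf).
    + exact: measurable_funeM.
    move=> l _; rewrite /f/= poweRM ?lee_fin ?powR_ge0//.
    rewrite poweR_EFin -powRrM q'q powRr1// muleCA lee_wpmul2l ?lee_fin//.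
    exact: HK.
  - by move=> l _; rewrite mule_ge0 ?lee_fin// level_sum_ge0.
  - by rewrite lee_fin ltW.
rewrite -/q -/q'.
have -> : K%:E * (\int[mu]_x (A x `^ q')) `^ q =
    (\int[mu]_x ((K `^ q')%:E * A x `^ q')) `^ q.
  rewrite ge0_integralZl//.
  - rewrite poweRM ?lee_fin ?powR_ge0//.
      by rewrite poweR_EFin -powRrM q'q powRr1// ltW.
    by apply: integral_ge0 => x _; exact: poweR_ge0.
  - exact: (measurableT_comp (measurable_poweR q')).
  - by move=> x _; exact: poweR_ge0.
  - by rewrite lee_fin powR_ge0.
apply: le_poweR; first exact: ltW.
  by apply: integral_ge0 => x _; exact: poweR_ge0.
apply: ge0_le_integral => //.
- by move=> x _; exact: poweR_ge0.
- apply: (measurableT_comp (measurable_poweR _)).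
  apply: (measurable_fun_fubini_tonelli_G (fun z => f z `^ q)).
    exact: (measurableT_comp (measurable_poweR q)).
  by move=> z; exact: poweR_ge0.
- by apply: measurable_funeM; exact: (measurableT_comp (measurable_poweR q')).
Qed.

Lemma int_esum_pow_le_mixed_distr (r : R) : (1 <= r)%R -> (r <= p)%R ->
  exists2 K : R, (0 < K)%R & forall a : int -> T -> R,
    (forall k x, 0 <= a k x)%R -> (forall k, measurable_fun [set: T] (a k)) ->
    \int[mu]_x (\esum_(k in [set: int]) (a k x `^ r)%:E) `^ (p / r) <=
    K%:E * (\int[lebesgue_measure]_l
      ((layer_weight r l)%:E * mixed_distr mu p gamma a l `^ (r / p))) `^ (p / r).
Proof.
move=> r1 rp; have r0 : (0 < r)%R by rewrite (lt_le_trans _ r1).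
have [K K0 HK] := esum_geometric_power theta_neq0 r0 p_gt0.
exists K => // a a0 ma.
pose q := (p / r)%R; pose q' := (r / p)%R.
have q1 : (1 <= q)%R by rewrite /q ler_pdivlMr// mul1r.
have q0 : (0 < q)%R by rewrite divr_gt0.
have q'0 : (0 < q')%R by rewrite divr_gt0.
have qV : (q^-1 = q')%R by rewrite /q invf_div.
have q'q : (q' * q = 1)%R by rewrite -qV mulVf// gt_eqF.
have weight0 l : (0 <= layer_weight r l)%R by rewrite layer_weight_ge0// ltW.
have mweight := @measurable_layer_weight R r.
pose G l x := level_sum p gamma a p l x.
have G0 l x : 0 <= G l x by exact: level_sum_ge0.
(* Here the geometric comparison comes before Minkowski: f dominates the weighted [level_sum] with
   exponent r, while its power q is linear in G and so integrates in x to [mixed_distr]. *)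
pose f (z : T * measurableTypeR R) := (K `^ q' * layer_weight r z.2)%:E * G z.2 z.1 `^ q'.
have c0 l : (0 <= K `^ q' * layer_weight r l)%R by rewrite mulr_ge0 ?powR_ge0.
have mG : measurable_fun [set: T * measurableTypeR R] (fun z => G z.2 z.1).
  have h := measurableT_comp (measurable_level_sum p gamma ma p) (@measurable_swap _ _ _ _).
  exact: h.
have mf : measurable_fun [set: T * measurableTypeR R] f.
  apply: emeasurable_funM; last exact: (measurableT_comp (measurable_poweR q')).
  apply/measurable_EFinP/measurable_funM => //.
  exact: (measurableT_comp mweight measurable_snd).
have f0 z : 0 <= f z by rewrite mule_ge0 ?poweR_ge0// lee_fin.
have mGl l : measurable_fun [set: T] (G l) by exact: (measurable_fun_pair1 l mG).
have mSx x : measurable_fun [set: measurableTypeR R]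
    (fun l => (layer_weight r l)%:E * level_sum p gamma a r l x).
  apply: emeasurable_funM; first exact/measurable_EFinP.
  exact: (measurable_fun_pair1 x (measurable_level_sum p gamma ma r)).
have D0 l : 0 <= mixed_distr mu p gamma a l.
  by rewrite -integral_level_sum//; apply: integral_ge0.
have mD : measurable_fun [set: measurableTypeR R] (mixed_distr mu p gamma a).
  exact: measurable_mixed_distr.
apply: (@le_trans _ _ (\int[mu]_x (\int[lebesgue_measure]_l f (x, l)) `^ q)).
  apply: ge0_le_integral => //.
  - by move=> x _; exact: poweR_ge0.
  - apply: (measurableT_comp (measurable_poweR _)).
    apply: measurable_esum_int => [k|k x]; last by rewrite lee_fin powR_ge0.
    exact/measurable_EFinP/(measurableT_comp (measurable_powR r)).
  - apply: (measurableT_comp (measurable_poweR _)).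
    exact: measurable_fun_fubini_tonelli_F.
  move=> x _; apply: le_poweR; first exact: ltW.
    by apply: esum_ge0 => k _; rewrite lee_fin powR_ge0.
  rewrite -(integral_layer_weight_level_sum p gamma a0 x r1).
  apply: ge0_le_integral => //.
  - by move=> l _; rewrite mule_ge0 ?lee_fin// level_sum_ge0.
  - exact: (measurable_fun_pair2 x mf).
  move=> l _; rewrite /f/= [(K `^ q' * _)%R]mulrC [X in _ <= X * _]EFinM -muleA lee_wpmul2l ?lee_fin//.
  rewrite -poweR_EFin -poweRM ?lee_fin ?(ltW K0)//.
  (* [HK] bounds the power q of the left-hand side; its q-th root is what is needed. *)
  rewrite -[leLHS](@poweRK _ q) ?gt_eqF ?level_sum_ge0// qV.
  by apply: le_poweR; [exact: ltW|exact: poweR_ge0|exact: HK].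
apply: (le_trans (@minkowski_integral _ _ _ _ _ mu lebesgue_measure q f q1 mf f0)).
have -> : K%:E * (\int[lebesgue_measure]_l
      ((layer_weight r l)%:E * mixed_distr mu p gamma a l `^ q')) `^ q =
    (\int[lebesgue_measure]_l
      ((K `^ q')%:E * ((layer_weight r l)%:E * mixed_distr mu p gamma a l `^ q'))) `^ q.
  have mm : measurable_fun [set: measurableTypeR R]
      (fun l => (layer_weight r l)%:E * mixed_distr mu p gamma a l `^ q').
    apply: emeasurable_funM; first exact/measurable_EFinP.
    exact: (measurableT_comp (measurable_poweR q')).
  have m0 l : 0 <= (layer_weight r l)%:E * mixed_distr mu p gamma a l `^ q'.
    by rewrite mule_ge0 ?poweR_ge0 ?lee_fin.
  rewrite ge0_integralZl// ?lee_fin ?powR_ge0// poweRM ?lee_fin ?powR_ge0//.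
    by rewrite poweR_EFin -powRrM q'q powRr1// ltW.
  exact: integral_ge0.
rewrite le_eqVlt; apply/orP; left; apply/eqP; congr (_ `^ q).
apply: eq_integral => l _; rewrite /f/=.
under eq_integral do rewrite poweRM ?poweR_ge0 ?lee_fin// -poweRrM q'q poweRe1//.
rewrite ge0_integralZl//; last by rewrite lee_fin powR_ge0.
rewrite integral_level_sum// poweRM ?lee_fin ?powR_ge0// qV.
by rewrite -[(_ `^ q) `^ q']poweRrM [(q * q')%R]mulrC q'q poweRe1 ?lee_fin// EFinM muleA.
Qed.

End mixed_estimates.

(** * The case r = +oo of the Triebel-Lizorkin comparison *)

Section weak_estimate.
Context {R : realType} d (T : measurableType d).
Variable mu : {sigma_finite_measure set T -> \bar R}.
Variables (p gamma : R).
Hypothesis p_gt0 : 0 < p.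
Local Open Scope ereal_scope.

Lemma measurable_ereal_sup_int (g : int -> T -> \bar R) :
  (forall k, measurable_fun [set: T] (g k)) ->
  measurable_fun [set: T] (fun x => ereal_sup (range (g ^~ x))).
Proof.
move=> mg; have := @measurable_fun_esups _ T R setT (fun n => g (int_of_nat n)).
move=> /(_ (fun n => mg _) 0%N); apply: eq_measurable_fun => x _.
congr ereal_sup; apply/seteqP; split => _ [n _ <-]; first by exists (int_of_nat n).
have [_ _ /(_ n Logic.I)[m _ <-]] := int_of_nat_bij.
by exists m => //=.
Qed.

(** A k in the superlevel set satisfies t_k < a_k(x) / l <= A x / l, where A is the supremum of the
    a_k. The geometric bound with M = A x / l then gives a Chebyshev inequality for A. *)
Lemma mixed_distr_weak_le : (gamma != 0)%R ->
  exists2 K : R, (0 < K)%R & forall a : int -> T -> R,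
    (forall k x, 0 <= a k x)%R -> (forall k, measurable_fun [set: T] (a k)) ->
    forall l : R, (0 < l)%R ->
    l%:E * mixed_distr mu p gamma a l `^ p^-1 <=
    K%:E * (\int[mu]_x ereal_sup (range (fun k => (a k x)%:E)) `^ p) `^ p^-1.
Proof.
move=> gamma0; have theta0 : (gamma / p != 0)%R by rewrite mulf_neq0// invr_eq0 gt_eqF.
have [K K0 HK] := esum_geometric_le theta0 p_gt0.
exists (K `^ p^-1)%R; first by rewrite powR_gt0.
move=> a a0 ma l l0.
pose A x := ereal_sup (range (fun k => (a k x)%:E)).
have aA k x : (a k x)%:E <= A x by apply: ereal_sup_ubound; exists k.
have A0 x : 0 <= A x by apply: le_trans (aA 0%R x); rewrite lee_fin.
have mA : measurable_fun [set: T] A.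
  by apply: measurable_ereal_sup_int => k; exact/measurable_EFinP.
have mAp : measurable_fun [set: T] (fun x => A x `^ p).
  exact: (measurableT_comp (measurable_poweR p)).
have GA x : level_sum p gamma a p l x <= (K * l `^ (- p))%:E * A x `^ p.
  have [Aoo|Aoo] := eqVneq (A x) +oo.
    by rewrite Aoo poweRyr ?gt_eqF// gt0_muley ?leey// lte_fin mulr_gt0// powR_gt0.
  have Afin : A x \is a fin_num by rewrite ge0_fin_numE// ltey.
  have fA0 : (0 <= fine (A x))%R by rewrite fine_ge0.
  apply: (le_trans (HK (fine (A x) / l)%R _ _ _)).
  - by rewrite divr_ge0// ltW.
  - move=> k; rewrite /superlevel/= /scaled => h.
    rewrite powRN -div1r ler_pdivrMr ?powR_gt0// mulrAC ler_pdivlMr// mul1r.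
    apply: (le_trans (ltW h)); rewrite mulrC ler_wpM2r ?powR_ge0//.
    by rewrite -lee_fin fineK.
  - have AE : A x `^ p = (fine (A x) `^ p)%:E by rewrite -poweR_EFin fineK.
    have lE : (l^-1 `^ p = l `^ (- p))%R by rewrite -powR_inv1 ?ltW// -powRrM mulN1r.
    by rewrite AE -EFinM lee_fin powRM ?invr_ge0 ?(ltW l0)// lE mulrAC mulrA.
(* With every factor under the p-th root, the claim reads l^p m(l) <= K int A^p. *)
have E : l%:E = ((l `^ p)%:E) `^ p^-1.
  by rewrite poweR_EFin -powRrM divff ?gt_eqF// powRr1// ltW.
have D0 : 0 <= mixed_distr mu p gamma a l.
  by rewrite -integral_level_sum//; apply: integral_ge0 => x _; exact: level_sum_ge0.
have I0 : 0 <= \int[mu]_x (A x `^ p) by apply: integral_ge0 => x _; exact: poweR_ge0.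
rewrite E -[(K `^ p^-1)%:E]poweR_EFin -!poweRM ?lee_fin ?powR_ge0 ?(ltW K0)//.
apply: le_poweR; first by rewrite invr_ge0 ltW.
  by rewrite mule_ge0// lee_fin powR_ge0.
have -> : K%:E * \int[mu]_x (A x `^ p) =
    (l `^ p)%:E * ((K * l `^ (- p))%:E * \int[mu]_x (A x `^ p)).
  rewrite muleA -EFinM; congr (_%:E * _).
  by rewrite mulrCA powRN divff ?mulr1// gt_eqF// powR_gt0.
rewrite lee_wpmul2l// ?lee_fin ?powR_ge0// -integral_level_sum//.
have c0 : (0 <= K * l `^ (- p))%R by rewrite mulr_ge0 ?powR_ge0 ?(ltW K0).
rewrite -ge0_integralZl//; last by move=> x _; exact: poweR_ge0.
apply: ge0_le_integral => //.
- by move=> x _; exact: level_sum_ge0.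
- exact: (measurable_fun_pair2 l (measurable_level_sum p gamma ma p)).
- exact: measurable_funeM.
Qed.

End weak_estimate.

(** * Comparison with the distribution functions of the single slices *)

Section slicewise_estimates.
Context {R : realType} d (T : measurableType d).
Variable mu : {sigma_finite_measure set T -> \bar R}.
Variables (p gamma : R).
Hypothesis p_gt0 : 0 < p.
Variable a : int -> T -> R.
Hypothesis measurable_a : forall k, measurable_fun [set: T] (a k).
Local Open Scope ereal_scope.

Lemma measurable_distr (b : T -> R) : measurable_fun [set: T] b ->
  measurable_fun [set: measurableTypeR R] (fun l => mu [set x | (l < b x)%R]).
Proof.
move=> mb.
have mlt : measurable_fun [set: measurableTypeR R * T] (fun z => (z.1 < b z.2)%R).
  apply: measurable_fun_ltr; first exact: measurable_fst.
  exact: (measurableT_comp mb measurable_snd).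
have mA : measurable [set z : measurableTypeR R * T | (z.1 < b z.2)%R].
  by move: mlt => /(_ measurableT [set true]); rewrite setTI preimage_true; exact.
apply: eq_measurable_fun (measurable_fun_xsection mu mA) => l _ /=.
by congr (mu _); apply/seteqP; split => x /=; rewrite /xsection/= inE.
Qed.

Let D k l := mu [set x | (l < scaled p gamma a k x)%R].

Let mD k : measurable_fun [set: measurableTypeR R] (D k).
Proof. exact: (measurable_distr (measurable_scaled p gamma measurable_a k)). Qed.

Let weighted_distr_pow (r : R) k l :
  ((2 `^ (- (k%:~R * gamma)))%:E * D k l) `^ (r / p) =
  ((2 `^ (- (k%:~R * (gamma / p)))) `^ r)%:E * D k l `^ (r / p).
Proof.
have E : ((2 `^ (- (k%:~R * gamma))) `^ (r / p) =
    (2 `^ (- (k%:~R * (gamma / p)))) `^ r :> R)%R.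
  by rewrite -!powRrM; congr (_ `^ _)%R; field; rewrite gt_eqF.
rewrite poweRM; first by rewrite poweR_EFin E.
  by rewrite lee_fin powR_ge0.
exact: measure_ge0.
Qed.

(** Tonelli's theorem in k and l, the power r/p turning the weight 2^(-k gamma) into 2^(-k theta r).
    The comparison with [mixed_distr] can then be made for each l separately. *)
Let esum_layer_weightE (r : R) : (1 <= r)%R ->
  \esum_(k in [set: int]) (((2 `^ (- (k%:~R * (gamma / p)))) `^ r)%:E *
    \int[lebesgue_measure]_l ((layer_weight r l)%:E * D k l `^ (r / p))) =
  \int[lebesgue_measure]_l ((layer_weight r l)%:E * \esum_(k in [set: int])
    (((2 `^ (- (k%:~R * gamma)))%:E * D k l) `^ (r / p))).
Proof.
move=> r1; have weight0 l : (0 <= layer_weight r l)%R by rewrite layer_weight_ge0// (le_trans _ r1).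
have mweight := @measurable_layer_weight R r.
have mk k : measurable_fun [set: measurableTypeR R]
    (fun l => (layer_weight r l)%:E * D k l `^ (r / p)).
  apply: emeasurable_funM; first exact/measurable_EFinP.
  exact: (measurableT_comp (measurable_poweR (r / p))).
have E k : (fun l => (layer_weight r l)%:E * ((2 `^ (- (k%:~R * gamma)))%:E * D k l) `^ (r / p)) =
    (fun l => ((2 `^ (- (k%:~R * (gamma / p)))) `^ r)%:E *
      ((layer_weight r l)%:E * D k l `^ (r / p))).
  by apply/funext => l; rewrite weighted_distr_pow muleCA.
transitivity (\int[lebesgue_measure]_l \esum_(k in [set: int])
    ((layer_weight r l)%:E * ((2 `^ (- (k%:~R * gamma)))%:E * D k l) `^ (r / p))); last first.
  by apply: eq_integral => l _; rewrite esum_intZl// => k; exact: poweR_ge0.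
rewrite integral_esum_int => [|k|k l].
- apply: eq_esum => k _; rewrite E ge0_integralZl//.
  by move=> l _; rewrite mule_ge0 ?lee_fin ?poweR_ge0.
- by rewrite E; exact: measurable_funeM.
- by rewrite mule_ge0 ?lee_fin ?poweR_ge0.
Qed.

Let mixed_distr_pow_measurable (r : R) : measurable_fun [set: measurableTypeR R]
  (fun l => (layer_weight r l)%:E * mixed_distr mu p gamma a l `^ (r / p)).
Proof.
apply: emeasurable_funM; first by apply/measurable_EFinP; exact: measurable_layer_weight.
apply: (measurableT_comp (measurable_poweR (r / p))).
exact: measurable_mixed_distr.
Qed.

Let esum_pow_measurable (r : R) : measurable_fun [set: measurableTypeR R]
  (fun l => (layer_weight r l)%:E * \esum_(k in [set: int])
    (((2 `^ (- (k%:~R * gamma)))%:E * D k l) `^ (r / p))).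
Proof.
apply: emeasurable_funM; first by apply/measurable_EFinP; exact: measurable_layer_weight.
apply: measurable_esum_int => [k|k l]; last exact: poweR_ge0.
by apply: (measurableT_comp (measurable_poweR (r / p))); exact: measurable_funeM.
Qed.

Lemma esum_int_distr_le (r : R) : (1 <= r)%R -> (p <= r)%R ->
  \esum_(k in [set: int]) (((2 `^ (- (k%:~R * (gamma / p)))) `^ r)%:E *
    \int[lebesgue_measure]_l ((layer_weight r l)%:E * D k l `^ (r / p))) <=
  \int[lebesgue_measure]_l ((layer_weight r l)%:E * mixed_distr mu p gamma a l `^ (r / p)).
Proof.
move=> r1 pr; rewrite esum_layer_weightE//; apply: ge0_le_integral => //.
- move=> l _; rewrite mule_ge0 ?lee_fin ?layer_weight_ge0 ?(le_trans _ r1)//.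
  by apply: esum_ge0 => k _; exact: poweR_ge0.
- move=> l _; rewrite lee_wpmul2l ?lee_fin ?layer_weight_ge0 ?(le_trans _ r1)//.
  apply: esum_poweR_le; first by rewrite ler_pdivlMr// mul1r.
  by move=> k; rewrite mule_ge0// lee_fin powR_ge0.
Qed.

Lemma esum_int_distr_ge (r : R) : (1 <= r)%R -> (r <= p)%R ->
  \int[lebesgue_measure]_l ((layer_weight r l)%:E * mixed_distr mu p gamma a l `^ (r / p)) <=
  \esum_(k in [set: int]) (((2 `^ (- (k%:~R * (gamma / p)))) `^ r)%:E *
    \int[lebesgue_measure]_l ((layer_weight r l)%:E * D k l `^ (r / p))).
Proof.
move=> r1 rp; rewrite esum_layer_weightE//; apply: ge0_le_integral => //.
- by move=> l _; rewrite mule_ge0 ?lee_fin ?poweR_ge0 ?layer_weight_ge0 ?(le_trans _ r1).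
- move=> l _; rewrite lee_wpmul2l ?lee_fin ?layer_weight_ge0 ?(le_trans _ r1)//.
  apply: esum_poweR_ge; last by move=> k; rewrite mule_ge0// lee_fin powR_ge0.
  by rewrite divr_gt0 ?(lt_le_trans _ r1)//= ler_pdivrMr// mul1r.
Qed.

End slicewise_estimates.

(** * Moduli and measurability on the product with the integers *)

Section complex_measurability.
Local Open Scope complex_scope.
Context {R : realType}.

Lemma cmod_ge0 (z : R[i]) : 0 <= cmod z.
Proof. by case: z => x y; exact: sqrtr_ge0. Qed.

Lemma cmod_real (c : R) : 0 <= c -> cmod c%:C = c.
Proof. by move=> c0; rewrite /cmod/= expr0n/= addr0 sqrtr_sqr ger0_norm. Qed.

Lemma cmodZ (c : R) (z : R[i]) : 0 <= c -> cmod (c%:C * z) = c * cmod z.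
Proof. by move=> c0; rewrite /cmod Normc.normcM -/(cmod c%:C) cmod_real. Qed.

Lemma measurable_cmod d (T : measurableType d) (g : T -> R[i]) :
  cmeasurable g -> measurable_fun [set: T] (fun x => cmod (g x)).
Proof.
case=> mr mi.
have -> : (fun x => cmod (g x)) =
    (fun x => (complex.Re (g x) ^+ 2 + complex.Im (g x) ^+ 2) `^ 2^-1).
  apply/funext => x; rewrite powR12_sqrt ?addr_ge0 ?sqr_ge0//.
  by rewrite /cmod; case: (g x).
apply: (measurableT_comp (measurable_powR 2^-1)).
by apply: measurable_funD; exact: measurable_funX.
Qed.

Lemma cmeasurableZ d (T : measurableType d) (c : R) (g : T -> R[i]) :
  cmeasurable g -> cmeasurable (fun x => c%:C * g x).
Proof.
case=> mr mi; split.
  have -> : (fun x => complex.Re (c%:C * g x)) = (fun x => c * complex.Re (g x)).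
    by apply/funext => x; case: (g x) => y z /=; rewrite mul0r subr0.
  exact: measurable_funM.
have -> : (fun x => complex.Im (c%:C * g x)) = (fun x => c * complex.Im (g x)).
  by apply/funext => x; case: (g x) => y z /=; rewrite mul0r addr0.
exact: measurable_funM.
Qed.

(** A preimage under h is the countable union of its slices, each times a singleton of the discrete
    space of integers. *)
Lemma measurable_fun_int_slices d (T : measurableType d) (h : T * int -> R) :
  (forall k, measurable_fun [set: T] (fun x => h (x, k))) ->
  measurable_fun [set: T * int] h.
Proof.
move=> mh _ Y mY; rewrite setTI.
have -> : h @^-1` Y = \bigcup_n
    ((fun x => h (x, int_of_nat n)) @^-1` Y `*` [set int_of_nat n]).
  apply/seteqP; split => [[x k] /= hY|[x k] [n _ [/= hY ->]]//].
  have [_ _ /(_ k Logic.I)[n _ nk]] := int_of_nat_bij.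
  by exists n => //=; rewrite nk.
apply: bigcupT_measurable => n; apply: measurableX => //.
by rewrite -[X in measurable X]setTI; exact: mh.
Qed.

Lemma cmeasurable_slicesP d (T : measurableType d) (c : int -> R) (u : int -> T -> R[i]) :
  (forall k, 0 < c k) ->
  cmeasurable (fun z : T * int => (c z.2)%:C * u z.2 z.1) <->
  (forall k, cmeasurable (u k)).
Proof.
move=> c0; split=> [[mr mi] k|mu]; last first.
  split; apply: measurable_fun_int_slices => k /=;
    by have [] := cmeasurableZ (c k) (mu k).
have -> : u k = (fun x => (c k)^-1%:C * ((c k)%:C * u k x)).
  apply/funext => x; rewrite mulrA -rmorphM mulVf ?mul1r//.
  by rewrite gt_eqF.
apply: cmeasurableZ; split.
  exact: (measurable_fun_pair1 k mr).
exact: (measurable_fun_pair1 k mi).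
Qed.

End complex_measurability.

(** * The Lorentz quasi-norm as an integral against d(l^r) *)

Section lorentz_qnorm_facts.
Local Open Scope complex_scope.
Context {R : realType} d (T : measurableType d).
Variable mu : {measure set T -> \bar R}.
Local Open Scope ereal_scope.

Lemma integral_layer_weightE (r : R) (h : R -> \bar R) : (1 <= r)%R ->
  measurable_fun [set: measurableTypeR R] h -> (forall l, 0 <= h l) ->
  r%:E * \int[lebesgue_measure]_(l in `]0%R, +oo[) ((l `^ r)%:E * h l * (l^-1)%:E) =
  \int[lebesgue_measure]_l ((layer_weight r l)%:E * h l).
Proof.
move=> r1 mh h0; have r0 : (0 <= r)%R by rewrite (le_trans _ r1).
transitivity (r%:E * \int[lebesgue_measure]_(l in `]0%R, +oo[) ((l `^ (r - 1))%:E * h l)).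
  congr (_ * _); apply: eq_integral => l; rewrite inE/= in_itv/= andbT => l0.
  have E : (l `^ (r - 1) = l `^ r * l^-1)%R.
    by rewrite powRB ?powRr1 ?(ltW l0)// (gt_eqF l0) implybT.
  by rewrite muleAC -EFinM E.
rewrite -ge0_integralZl//.
- rewrite [LHS]integral_mkcond epatch_indic; apply: eq_integral => l _.
  by rewrite /layer_weight /= EFinM EFinM muleA -!muleA [h l * _]muleC.
- apply: measurable_funTS; apply: emeasurable_funM => //.
  by apply/measurable_EFinP; exact: measurable_powR.
- by move=> l _; rewrite mule_ge0// lee_fin powR_ge0.
Qed.

Lemma lorentz_qnorm_layer_weight (p r : R) (g : T -> R[i]) (D : R -> \bar R) : (1 <= r)%R ->
  (forall l, mu [set x | (l < cmod (g x))%R] = D l) ->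
  measurable_fun [set: measurableTypeR R] D ->
  lorentz_qnorm mu p r%:E g =
  (\int[lebesgue_measure]_l ((layer_weight r l)%:E * D l `^ (r / p))) `^ r^-1.
Proof.
move=> r1 gD mD; rewrite /lorentz_qnorm; under eq_integral do rewrite gD.
rewrite integral_layer_weightE//; last by move=> l; exact: poweR_ge0.
exact: (measurableT_comp (measurable_poweR (r / p))).
Qed.

Lemma lorentz_qnorm_ge0 (p : R) (r : \bar R) (g : T -> R[i]) :
  0 <= lorentz_qnorm mu p r g.
Proof.
have h : 0 <= ereal_sup [set l%:E * mu [set x | (l < cmod (g x))%R] `^ p^-1
    | l in [set l : R | (0 < l)%R]].
  apply: (@le_trans _ _ (1%:E * mu [set x | (1 < cmod (g x))%R] `^ p^-1)).
    by rewrite mul1e poweR_ge0.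
  by apply: ereal_sup_ubound; exists 1%R => //=; exact: ltr01.
by case: r => [r||]; [exact: poweR_ge0|exact: h|exact: h].
Qed.

(** Positivity is inherited from the quasi-norm through the lower bound of the equivalence. *)
Lemma lorentz_norm_ge0 (p : R) (r : \bar R) (N : lorentz_norm mu p r) (g : T -> R[i]) :
  cmeasurable g -> 0 <= N g.
Proof.
move=> mg; have [c [C [c0 C0 /(_ g mg)[+ _]]]] := lnorm_equiv N.
by apply: le_trans; rewrite mule_ge0 ?lorentz_qnorm_ge0// lee_fin ltW.
Qed.

End lorentz_qnorm_facts.

(** * The four norm inequalities *)

Section norm_inequalities.
Local Open Scope complex_scope.
Context {R : realType} {d : nat}.
Variables (s p gamma : R).
Hypothesis p_gt1 : 1 < p.
Local Notation Rd := 'rV[R]_d.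
Local Notation leb := (@lebesgue_rV R d).
Local Open Scope ereal_scope.

Let p_gt0 : (0 < p)%R. Proof. exact: lt_trans p_gt1. Qed.

(** For [u = LP phi f] this is [Pop phi (s + gamma / p) f]. Arbitrary families u keep distributions
    out of the estimates. *)
Definition weighted_pieces (u : int -> Rd -> R[i]) (z : Rd * int) : R[i] :=
  ((2 `^ (z.2%:~R * (s + gamma / p)))%:C * u z.2 z.1)%R.

Definition weighted_mod (u : int -> Rd -> R[i]) (k : int) (x : Rd) : R :=
  (2 `^ (k%:~R * s) * cmod (u k x))%R.

Lemma cmeasurable_weighted_piecesP u :
  cmeasurable (weighted_pieces u) <-> forall k, cmeasurable (u k).
Proof.
apply: (@cmeasurable_slicesP _ _ _ (fun k : int => (2 `^ (k%:~R * (s + gamma / p)))%R)).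
by move=> k; rewrite powR_gt0.
Qed.

Let weighted_mod_ge0 u k x : (0 <= weighted_mod u k x)%R.
Proof. by rewrite mulr_ge0 ?powR_ge0 ?cmod_ge0. Qed.

Let measurable_weighted_mod u k : cmeasurable (u k) ->
  measurable_fun [set: Rd] (weighted_mod u k).
Proof. by move=> mu; apply: measurable_funM => //; exact: measurable_cmod. Qed.

Lemma cmod_weighted_pieces u k x :
  cmod (weighted_pieces u (x, k)) = scaled p gamma (weighted_mod u) k x.
Proof.
rewrite /weighted_pieces cmodZ ?powR_ge0// /scaled /weighted_mod /= mulrA -powRD.
  by congr (_ `^ _ * _)%R; rewrite mulrDr addrC.
by rewrite pnatr_eq0 implybT.
Qed.

Lemma mu_gamma_superlevel u l :
  mu_gamma gamma [set z | (l < cmod (weighted_pieces u z))%R] =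
  mixed_distr leb p gamma (weighted_mod u) l.
Proof.
apply: eq_esum => k _; congr (_ * leb _).
by apply/seteqP; split => x /=; rewrite cmod_weighted_pieces.
Qed.

(** By homogeneity, passing to the slice of [weighted_pieces] costs the factor 2^(-k theta), the
    very one that [mixed_distr] provides after its root of order p. *)
Let besov_term (r : \bar R) (N : lorentz_norm leb p r) u k : cmeasurable (u k) ->
  (2 `^ (k%:~R * s))%:E * N (u k) =
  (2 `^ (- (k%:~R * (gamma / p))))%:E * N (fun x => weighted_pieces u (x, k)).
Proof.
move=> mu; rewrite /weighted_pieces/= lnormZ// cmod_real ?powR_ge0// muleA -EFinM -powRD.
  by congr ((_ `^ _)%R%:E * _); ring.
by rewrite pnatr_eq0 implybT.
Qed.

Let cmeasurable_piece u k : cmeasurable (u k) ->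
  cmeasurable (fun x => weighted_pieces u (x, k)).
Proof. by move=> mu; exact: (cmeasurableZ (2 `^ (k%:~R * (s + gamma / p))) mu). Qed.

Let mixed_qnorm u (r : R) : (1 <= r)%R -> (forall k, cmeasurable (u k)) ->
  lorentz_qnorm (@mu_gamma R d gamma) p r%:E (weighted_pieces u) =
  (\int[lebesgue_measure]_l
    ((layer_weight r l)%:E * mixed_distr leb p gamma (weighted_mod u) l `^ (r / p))) `^ r^-1.
Proof.
move=> r1 mu; apply: lorentz_qnorm_layer_weight => //.
  by move=> l; exact: mu_gamma_superlevel.
by apply: measurable_mixed_distr => // k; exact: measurable_weighted_mod.
Qed.

Let slice_distr u k l : leb [set x | (l < cmod (weighted_pieces u (x, k)))%R] =
  leb [set x | (l < scaled p gamma (weighted_mod u) k x)%R].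
Proof. by congr (leb _); apply/seteqP; split => x /=; rewrite cmod_weighted_pieces. Qed.

Let slice_qnorm u k (r : R) : (1 <= r)%R -> cmeasurable (u k) ->
  (\int[lebesgue_measure]_l ((layer_weight r l)%:E *
    leb [set x | (l < scaled p gamma (weighted_mod u) k x)%R] `^ (r / p))) =
  lorentz_qnorm leb p r%:E (fun x => weighted_pieces u (x, k)) `^ r.
Proof.
move=> r1 mu; rewrite (lorentz_qnorm_layer_weight p r1 (slice_distr u k)).
  rewrite poweRVK// ?gt_eqF ?(lt_le_trans _ r1)//.
  apply: integral_ge0 => l _.
  by rewrite mule_ge0 ?poweR_ge0// lee_fin layer_weight_ge0 ?(le_trans _ r1).
apply: measurable_distr; apply: measurable_funM => //.
exact: measurable_weighted_mod.
Qed.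

(* [lnormZ] for NX replaces the change of variables that would compute the
   quasi-norm of a multiple of a function. *)
Lemma besov_le_calB (r : \bar R) (NX : lorentz_norm leb p r)
    (NY : lorentz_norm (@mu_gamma R d gamma) p r) : p%:E <= r ->
  exists2 C : R, (0 < C)%R & forall u, (forall k, cmeasurable (u k)) ->
    ell_norm r (fun k => (2 `^ (k%:~R * s))%:E * NX (u k)) <=
    C%:E * NY (weighted_pieces u).
Proof.
have [cX [CX [cX0 CX0 HX]]] := lnorm_equiv NX.
have [cY [CY [cY0 CY0 HY]]] := lnorm_equiv NY.
(* [CX] passes from [NX] to the quasi-norm on R^d, and 1/[cY] from the quasi-norm on the product to
   [NY]. *)
move=> pr; exists (CX / cY)%R; first by rewrite divr_gt0.
move=> u mu; have mL : cmeasurable (weighted_pieces u)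
  by apply/cmeasurable_weighted_piecesP.
suff H : ell_norm r (fun k => (2 `^ (k%:~R * s))%:E * NX (u k)) <=
    CX%:E * lorentz_qnorm (@mu_gamma R d gamma) p r (weighted_pieces u).
  apply: (le_trans H); rewrite EFinM -muleA lee_wpmul2l ?lee_fin ?(ltW CX0)//.
  by rewrite lee_pdivlMl//; have [] := HY _ mL.
have term_le k : (2 `^ (k%:~R * s))%:E * NX (u k) <=
    CX%:E * ((2 `^ (- (k%:~R * (gamma / p))))%:E *
      lorentz_qnorm leb p r (fun x => weighted_pieces u (x, k))).
  rewrite besov_term// muleCA lee_wpmul2l ?lee_fin ?powR_ge0//.
  by have [] := HX _ (cmeasurable_piece (mu k)).
have term_ge0 k : 0 <= (2 `^ (k%:~R * s))%:E * NX (u k).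
  by rewrite mule_ge0 ?lorentz_norm_ge0// lee_fin powR_ge0.
case: r NX NY HX HY pr mL term_le term_ge0 => [r||//] NX NY HX HY pr mL term_le term_ge0.
  have {}pr : (p <= r)%R by [].
  have r0 : (0 < r)%R by rewrite (lt_le_trans _ pr).
  have r1 : (1 <= r)%R by rewrite (le_trans (ltW p_gt1)).
  rewrite mixed_qnorm// /ell_norm.
  have -> : CX%:E = ((CX `^ r)%:E) `^ r^-1.
    by rewrite poweR_EFin -powRrM divff ?gt_eqF// powRr1// ltW.
  have I0 : 0 <= \int[lebesgue_measure]_l
      ((layer_weight r l)%:E * mixed_distr leb p gamma (weighted_mod u) l `^ (r / p)).
    apply: integral_ge0 => l _.
    by rewrite mule_ge0 ?poweR_ge0// lee_fin layer_weight_ge0 ?(ltW r0).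
  rewrite -poweRM ?lee_fin ?powR_ge0//; apply: le_poweR.
  - by rewrite invr_ge0 ltW.
  - by apply: esum_ge0 => k _; exact: poweR_ge0.
  have := @esum_int_distr_le _ _ _ leb p gamma p_gt0 (weighted_mod u)
    (fun k => measurable_weighted_mod (mu k)) r r1 pr.
  have c0 : 0 <= (CX `^ r)%:E by rewrite lee_fin powR_ge0.
  move=> H; apply: le_trans (lee_wpmul2l c0 H).
  rewrite -esum_intZl ?powR_ge0//; last first.
    move=> k; rewrite mule_ge0 ?lee_fin ?powR_ge0//; apply: integral_ge0 => l _.
    by rewrite mule_ge0 ?poweR_ge0// lee_fin layer_weight_ge0 ?(ltW r0).
  apply: le_esum => k _; rewrite slice_qnorm//.
  rewrite -[(CX `^ r)%:E]poweR_EFin -[((_ `^ _) `^ r)%:E]poweR_EFin.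
  rewrite -!poweRM ?lee_fin ?powR_ge0 ?mule_ge0 ?lorentz_qnorm_ge0
    ?lee_fin ?powR_ge0 ?(ltW CX0)//.
  by apply: le_poweR => //; exact: ltW.
(* The case r = +oo: for each l, a single term of the sum [mixed_distr] is at most the sum. *)
rewrite /ell_norm; apply: ge_ereal_sup => _ [k _ <-].
apply: (le_trans (term_le k)); rewrite lee_wpmul2l ?lee_fin ?(ltW CX0)//.
set t := (2 `^ _)%R; have t0 : (0 < t)%R by rewrite powR_gt0.
rewrite -lee_pdivlMl//; apply: ge_ereal_sup => _ [l /= l0 <-].
rewrite lee_pdivlMl// slice_distr.
apply: (@le_trans _ _ (l%:E * mixed_distr leb p gamma (weighted_mod u) l `^ p^-1)).
  rewrite muleCA lee_wpmul2l ?lee_fin ?(ltW l0)//.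
  have -> : t%:E = ((t `^ p)%:E) `^ p^-1.
    by rewrite poweR_EFin -powRrM divff ?gt_eqF// powRr1// ltW.
  rewrite -poweRM ?lee_fin ?powR_ge0//; apply: le_poweR.
  - by rewrite invr_ge0 ltW.
  - by rewrite mule_ge0 ?lee_fin ?powR_ge0.
  have -> : (t `^ p = 2 `^ (- (k%:~R * gamma)))%R.
    by rewrite /t -powRrM mulNr -mulrA divfK ?gt_eqF.
  have term_k j : 0 <= (2 `^ (- (j%:~R * gamma)))%:E *
      leb [set x | (l < scaled p gamma (weighted_mod u) j x)%R].
    by rewrite mule_ge0 ?lee_fin ?powR_ge0.
  exact: (le_esum_term k term_k).
rewrite -mu_gamma_superlevel; apply: ereal_sup_ubound.
by exists l.
Qed.

Let fin_exponent (r : \bar R) : 1%:E <= r <= p%:E ->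
  exists2 r' : R, (1 <= r' <= p)%R & r = r'%:E.
Proof. by case: r => [r rp|/andP[_]|/andP[]] //; exists r. Qed.

Lemma calB_le_besov (r : \bar R) (NX : lorentz_norm leb p r)
    (NY : lorentz_norm (@mu_gamma R d gamma) p r) : 1%:E <= r <= p%:E ->
  exists2 C : R, (0 < C)%R & forall u, (forall k, cmeasurable (u k)) ->
    NY (weighted_pieces u) <=
    C%:E * ell_norm r (fun k => (2 `^ (k%:~R * s))%:E * NX (u k)).
Proof.
move=> /fin_exponent[r' /andP[r1 rp] rE]; subst r; rename r' into r.
have [cX [CX [cX0 CX0 HX]]] := lnorm_equiv NX.
have [cY [CY [cY0 CY0 HY]]] := lnorm_equiv NY.
have r0 : (0 < r)%R by rewrite (lt_le_trans _ r1).
have b0 : (0 < cX^-1)%R by rewrite invr_gt0.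
exists (CY / cX)%R; first by rewrite divr_gt0.
move=> u mu; have mL : cmeasurable (weighted_pieces u)
  by apply/cmeasurable_weighted_piecesP.
have [_ /le_trans] := HY _ mL; apply.
rewrite EFinM -muleA lee_wpmul2l ?lee_fin ?(ltW CY0)// mixed_qnorm// /ell_norm.
have -> : cX^-1%:E = ((cX^-1 `^ r)%:E) `^ r^-1.
  by rewrite poweR_EFin -powRrM divff ?gt_eqF// powRr1// ltW.
have term_ge0 k : 0 <= (2 `^ (k%:~R * s))%:E * NX (u k).
  by rewrite mule_ge0 ?lorentz_norm_ge0// lee_fin powR_ge0.
rewrite -poweRM ?lee_fin ?powR_ge0//; last by apply: esum_ge0 => k _; exact: poweR_ge0.
apply: le_poweR.
- by rewrite invr_ge0 ltW.
- apply: integral_ge0 => l _.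
  by rewrite mule_ge0 ?poweR_ge0// lee_fin layer_weight_ge0 ?(ltW r0).
have := @esum_int_distr_ge _ _ _ leb p gamma p_gt0 (weighted_mod u)
  (fun k => measurable_weighted_mod (mu k)) r r1 rp.
move=> /le_trans; apply.
rewrite -esum_intZl ?powR_ge0//; last by move=> k; exact: poweR_ge0.
apply: le_esum => k _; rewrite slice_qnorm//.
rewrite -[(cX^-1 `^ r)%:E]poweR_EFin -[((_ `^ _) `^ r)%:E]poweR_EFin.
rewrite -!poweRM ?lee_fin ?powR_ge0 ?mule_ge0 ?lorentz_qnorm_ge0
  ?lorentz_norm_ge0 ?lee_fin ?powR_ge0 ?(ltW b0)//.
apply: le_poweR; [exact: ltW|by rewrite mule_ge0 ?lorentz_qnorm_ge0 ?lee_fin ?powR_ge0|].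
rewrite besov_term// muleCA lee_wpmul2l ?lee_fin ?powR_ge0// lee_pdivlMl//.
by have [] := HX _ (cmeasurable_piece (mu k)).
Qed.

Definition triebel_norm (r : \bar R) (u : int -> Rd -> R[i]) : \bar R :=
  Lnorm leb p%:E (fun x => ell_norm r (fun k => (weighted_mod u k x)%:E)).

Let triebel_normE (r : R) u :
  triebel_norm r%:E u =
  (\int[leb]_x (\esum_(k in [set: int]) (weighted_mod u k x `^ r)%:E) `^ (p / r)) `^ p^-1.
Proof.
rewrite /triebel_norm unlock; congr (_ `^ _); apply: eq_integral => x _.
rewrite gee0_abs; last by rewrite /ell_norm; exact: poweR_ge0.
rewrite /ell_norm -poweRrM mulrC; congr (_ `^ _).
Qed.

Lemma calB_le_triebel (r : \bar R) (NY : lorentz_norm (@mu_gamma R d gamma) p r) :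
  (gamma != 0)%R -> p%:E <= r ->
  exists2 C : R, (0 < C)%R & forall u, (forall k, cmeasurable (u k)) ->
    NY (weighted_pieces u) <= C%:E * triebel_norm r u.
Proof.
move=> gamma0; case: r NY => [r||//] NY pr;
  have [cY [CY [cY0 CY0 HY]]] := lnorm_equiv NY; last first.
  have [K K0 HK] := mixed_distr_weak_le leb p_gt0 gamma0.
  exists (CY * K)%R; first by rewrite mulr_gt0.
  move=> u mu; have mL : cmeasurable (weighted_pieces u)
    by apply/cmeasurable_weighted_piecesP.
  have [_ /le_trans] := HY _ mL; apply.
  rewrite EFinM -muleA lee_wpmul2l ?lee_fin ?(ltW CY0)//.
  apply: ge_ereal_sup => _ [l /= l0 <-]; rewrite mu_gamma_superlevel.
  apply: (le_trans (HK _ (weighted_mod_ge0 u)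
    (fun k => measurable_weighted_mod (mu k)) l l0)).
  rewrite lee_wpmul2l ?lee_fin ?(ltW K0)// /triebel_norm unlock.
  rewrite le_eqVlt; apply/orP; left; apply/eqP; congr (_ `^ _).
  apply: eq_integral => x _; rewrite gee0_abs// /ell_norm.
  apply: (@le_trans _ _ (weighted_mod u 0%R x)%:E); first by rewrite lee_fin.
  by apply: ereal_sup_ubound; exists 0%R.
have {}pr : (p <= r)%R by [].
have r0 : (0 < r)%R by rewrite (lt_le_trans _ pr).
have r1 : (1 <= r)%R by rewrite (le_trans (ltW p_gt1)).
have [K K0 HK] := int_mixed_distr_le_esum_pow leb p_gt0 gamma0 r1 pr.
exists (CY * K `^ r^-1)%R; first by rewrite mulr_gt0 ?powR_gt0.
move=> u mu; have mL : cmeasurable (weighted_pieces u)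
  by apply/cmeasurable_weighted_piecesP.
have [_ /le_trans] := HY _ mL; apply.
rewrite EFinM -muleA lee_wpmul2l ?lee_fin ?(ltW CY0)// mixed_qnorm// triebel_normE.
set B := integral leb _ _.
have B0 : 0 <= B by apply: integral_ge0 => x _; exact: poweR_ge0.
(* The integral estimate bounds the r-th power of the quasi-norm; its r-th root turns B^(r/p) into
   B^(1/p), the Triebel-Lizorkin norm. *)
have -> : (K `^ r^-1)%:E * B `^ p^-1 = (K%:E * B `^ (r / p)) `^ r^-1.
  rewrite poweRM ?lee_fin ?(ltW K0) ?poweR_ge0// -poweRrM poweR_EFin.
  by rewrite mulrAC divff ?mul1r// gt_eqF.
apply: le_poweR.
- by rewrite invr_ge0 ltW.
- apply: integral_ge0 => l _.
  by rewrite mule_ge0 ?poweR_ge0// lee_fin layer_weight_ge0 ?(ltW r0).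
by apply: HK; [exact: weighted_mod_ge0|move=> k; exact: measurable_weighted_mod].
Qed.

Lemma triebel_le_calB (r : \bar R) (NY : lorentz_norm (@mu_gamma R d gamma) p r) :
  (gamma != 0)%R -> 1%:E <= r <= p%:E ->
  exists2 C : R, (0 < C)%R & forall u, (forall k, cmeasurable (u k)) ->
    triebel_norm r u <= C%:E * NY (weighted_pieces u).
Proof.
move=> gamma0 /fin_exponent[r' /andP[r1 rp] rE]; subst r; rename r' into r.
have [cY [CY [cY0 CY0 HY]]] := lnorm_equiv NY.
have r0 : (0 < r)%R by rewrite (lt_le_trans _ r1).
have [K K0 HK] := int_esum_pow_le_mixed_distr leb p_gt0 gamma0 r1 rp.
exists (K `^ p^-1 / cY)%R; first by rewrite divr_gt0 ?powR_gt0.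
move=> u mu; have mL : cmeasurable (weighted_pieces u)
  by apply/cmeasurable_weighted_piecesP.
apply: (@le_trans _ _ ((K `^ p^-1)%:E *
    lorentz_qnorm (@mu_gamma R d gamma) p r%:E (weighted_pieces u))); last first.
  rewrite EFinM -muleA lee_wpmul2l ?lee_fin ?powR_ge0// lee_pdivlMl//.
  by have [] := HY _ mL.
rewrite mixed_qnorm// triebel_normE; set I := integral lebesgue_measure _ _.
have I0 : 0 <= I.
  apply: integral_ge0 => l _.
  by rewrite mule_ge0 ?poweR_ge0// lee_fin layer_weight_ge0 ?(ltW r0).
(* This time the estimate concerns the p-th power of the Triebel-Lizorkin norm, so the root is of
   order p. *)
have -> : (K `^ p^-1)%:E * I `^ r^-1 = (K%:E * I `^ (p / r)) `^ p^-1.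
  rewrite poweRM ?lee_fin ?(ltW K0) ?poweR_ge0// -poweRrM poweR_EFin.
  by rewrite mulrAC divff ?mul1r// gt_eqF.
apply: le_poweR.
- by rewrite invr_ge0 ltW.
- by apply: integral_ge0 => x _; exact: poweR_ge0.
by apply: HK; [exact: weighted_mod_ge0|move=> k; exact: measurable_weighted_mod].
Qed.

End norm_inequalities.

Theorem theorem1p4 (R : realType) (d : nat) (hd : (0 < d)%N)
    (phi : 'rV[R]_d -> R[i]) (hphi : LP_cutoff phi)
    (s p : R) (hp : 1 < p) :
  (forall (gamma : R) (r : \bar R)
      (NX : lorentz_norm (@lebesgue_rV R d) p r)
      (NY : lorentz_norm (@mu_gamma R d gamma) p r),
    ((p%:E <= r)%E ->
      embeds (calB_space phi s NY) (besov_lorentz_space phi s r NX)) /\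
    ((1%:E <= r <= p%:E)%E ->
      embeds (besov_lorentz_space phi s r NX) (calB_space phi s NY))) /\
  (forall (gamma : R) (r : \bar R)
      (NY : lorentz_norm (@mu_gamma R d gamma) p r), gamma != 0 ->
    ((p%:E <= r)%E ->
      embeds (triebel_lizorkin_space phi s p r) (calB_space phi s NY)) /\
    ((1%:E <= r <= p%:E)%E ->
      embeds (calB_space phi s NY) (triebel_lizorkin_space phi s p r))).
Proof.
have lty_of_le (C : R) (x y : \bar R) :
    0 < C -> (y <= C%:E * x)%E -> (x < +oo)%E -> (y < +oo)%E.
  by move=> C0 yx xoo; apply: (le_lt_trans yx); rewrite lte_mul_pinfty// lee_fin ltW.
(* Membership includes measurability, on the product for one space and slice by slice for the other;
   the two requirements agree, so only finiteness of the norm remains to be transferred. *)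
have measP gamma f : cmeasurable (Pop phi (s + gamma / p) f) <->
    (forall k, cmeasurable (LP phi f k)).
  exact: (cmeasurable_weighted_piecesP s p gamma (LP phi f)).
split=> [gamma r NX NY|gamma r NY gamma0]; split=> rp.
- have [C C0 HC] := besov_le_calB s hp NX NY rp.
  exists C => // f [/= /measP mf foo].
  by split; [split => //; exact: lty_of_le (HC _ mf) foo|exact: HC].
- have [C C0 HC] := calB_le_besov s hp NX NY rp.
  exists C => // f [/= mf foo]; split; last exact: HC.
  by split; [exact/measP|exact: lty_of_le (HC _ mf) foo].
- have [C C0 HC] := calB_le_triebel s hp NY gamma0 rp.
  exists C => // f [/= mf foo]; split; last exact: HC.
  by split; [exact/measP|exact: lty_of_le (HC _ mf) foo].
- have [C C0 HC] := triebel_le_calB s hp NY gamma0 rp.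
  exists C => // f [/= /measP mf foo].
  by split; [split => //; exact: lty_of_le (HC _ mf) foo|exact: HC].
Qed.
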